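(* Let $(R,\mathfrak m,k)$ be an equicharacteristic Cohen-Macaulay local ring of dimension $d\ge1$ with infinite residue field and let $I$ be an ideal of $R$. If $I$ is a stretched $\mathfrak m$-primary ideal, then $I$ is a $j$-stretched ideal.
   Context: $\lambda$ denotes length. An ideal $J\subseteq I$ is a reduction of $I$ if $I^{n+1}=JI^n$ for some $n\ge0$; it is minimal if minimal under inclusion. An $\mathfrak m$-primary ideal $I$ is stretched if there exists a minimal reduction $H$ of $I$ such that $H\cap I^2=HI$ and $\lambda\big(I^2/((H\cap I^2)+I^3)\big)\le1$ (this length is the value $HF_{I/H}(2)$ of the Hilbert function of $I/H$ on $R/H$). General elements: fix generators $I=(a_1,\dots,a_s)$. An assertion holds for general elements $x_1,\dots,x_t$ of $I$ if there is a Zariski dense open subset $U\subseteq k^{ts}$ such that it holds for all $x_i=\sum_{j}\lambda_{ij}a_j$ with $(\lambda_{ij})\in R^{ts}$ whose image in $k^{ts}$ lies in $U$. For $x_1,\dots,x_d$ general elements of $I$ let $J_{d-1}=(x_1,\dots,x_{d-1})$, $J_{d-1}:I^\infty=\{b\in R: bI^\delta\subseteq J_{d-1}\text{ for some }\delta>0\}$, $\overline R=R/(J_{d-1}:I^\infty)$, and let a bar denote images in $\overline R$. An ideal $I$ of analytic spread $d$ (in particular any $\mathfrak m$-primary ideal) is $j$-stretched if $\lambda\big(\overline I^2/(x_d\overline I+\overline I^3)\big)\le1$ for general $x_1,\dots,x_d$. *)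

(* Defs.v *)
From HB Require Import structures.
From mathcomp Require Import all_boot all_order all_algebra.
From mathcomp Require Import generic_quotient ring_quotient.
From mathcomp Require Import boolp classical_sets cardinality.
From mathcomp Require Import mpoly.

Set Implicit Arguments.
Unset Strict Implicit.
Unset Printing Implicit Defensive.

Import GRing.Theory.

Local Open Scope classical_set_scope.
Local Open Scope ring_scope.

Section Ideals.
Variable R : comPzRingType.
Implicit Types (I J K m : set R) (x y : R) (n : nat).

Definition is_ideal I : Prop :=
  [/\ I 0, forall x y, I x -> I y -> I (x + y) & forall x y, I y -> I (x * y)].

Definition ideal_gen (S : set R) : set R := smallest is_ideal S.

Definition ideal_add I J : set R := [set x + y | x in I & y in J].

Definition ideal_mul I J : set R := ideal_gen [set x * y | x in I & y in J].

Fixpoint ideal_pow I n : set R :=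
  if n is n'.+1 then ideal_mul (ideal_pow I n') I else [set: R].

Definition radical I : set R := [set x | exists n, I (x ^+ n)].

Definition prime_ideal I : Prop :=
  [/\ is_ideal I, ~ I 1 & forall x y, I (x * y) -> I x \/ I y].

Definition primary_ideal I : Prop :=
  [/\ is_ideal I, ~ I 1 & forall x y, I (x * y) -> I x \/ radical I y].

Definition maximal_ideal m : Prop :=
  [/\ is_ideal m, ~ m 1
    & forall I, is_ideal I -> ~ I 1 -> m `<=` I -> I = m].

Definition m_primary m I : Prop := primary_ideal I /\ radical I = m.

(* [J : I^oo] *)
Definition saturation J I : set R :=
  [set b | exists2 n, (0 < n)%N & forall c, ideal_pow I n c -> J (b * c)].

(* [length_le A B n] is lambda(A/B) <= n for ideals B <= A: the submodules of
   A/B are the N/B for N an ideal with B <= N <= A, and the length is the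
   supremum of the lengths l of the strict chains N_0 < ... < N_l of these. *)
Definition length_le (A B : set R) n : Prop :=
  forall (l : nat) (N : nat -> set R),
    (forall i, (i <= l)%N -> [/\ is_ideal (N i), B `<=` N i & N i `<=` A]) ->
    (forall i, (i < l)%N -> N i `<` N i.+1) ->
    (l <= n)%N.

Definition noetherian : Prop :=
  forall I, is_ideal I -> exists n (a : 'I_n -> R), I = ideal_gen (range a).

Definition is_local m : Prop :=
  maximal_ideal m /\ forall m', maximal_ideal m' -> m' = m.

Definition prime_chain n (P : nat -> set R) : Prop :=
  (forall i, (i <= n)%N -> prime_ideal (P i)) /\
  (forall i, (i < n)%N -> P i `<` P i.+1).

Definition krull_dim n : Prop :=
  (exists P, prime_chain n P) /\
  (forall l P, prime_chain l P -> (l <= n)%N).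

Definition regular_sequence (xs : seq R) : Prop :=
  ~ ideal_gen [set` xs] 1 /\
  forall i, (i < size xs)%N -> forall b,
    ideal_gen [set` take i xs] (b * xs`_i) -> ideal_gen [set` take i xs] b.

Definition depth m n : Prop :=
  (exists xs, [/\ size xs = n, [set` xs] `<=` m & regular_sequence xs]) /\
  (forall xs, [set` xs] `<=` m -> regular_sequence xs -> (size xs <= n)%N).

Definition cohen_macaulay_local m : Prop :=
  [/\ noetherian, is_local m & exists2 n, krull_dim n & depth m n].

Definition reduction J I : Prop :=
  [/\ is_ideal J, J `<=` I
    & exists n, ideal_pow I n.+1 = ideal_mul J (ideal_pow I n)].

Definition minimal_reduction J I : Prop :=
  reduction J I /\ forall J', reduction J' I -> J' `<=` J -> J' = J.

Definition stretched m I : Prop :=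
  m_primary m I /\
  exists H, [/\ minimal_reduction H I,
    H `&` ideal_pow I 2 = ideal_mul H I
    & length_le (ideal_pow I 2)
        (ideal_add (H `&` ideal_pow I 2) (ideal_pow I 3)) 1].

Lemma ideal_gen_is_ideal S : is_ideal (ideal_gen S).
Proof.
split=> [J []|x y Sx Sy J JS|x y Sy J JS]; first by case.
- by have [[_ JD _] _] := JS; apply: JD; [exact: Sx|exact: Sy].
- by have [[_ _ JM] _] := JS; apply: JM; exact: Sy.
Qed.

End Ideals.

Arguments noetherian : clear implicits.
Arguments krull_dim : clear implicits.

(* The quotient R/(S) by the ideal generated by S.  The library's quotient rings
   require a proper ideal, while here R/(S) may be the zero ring; only its
   additive quotient is reused. *)
Section QuotientRing.
Variables (R : comPzRingType) (S : set R).

Definition gen_mem : {pred R} := fun x => `[< ideal_gen S x >].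

Lemma gen_memP x : reflect (ideal_gen S x) (x \in gen_mem).
Proof. exact: asboolP. Qed.

Lemma gen_mem_zmod_closed : zmod_closed gen_mem.
Proof.
have [S0 SD SM] := ideal_gen_is_ideal S.
split=> [|x y /gen_memP Sx /gen_memP Sy]; apply/gen_memP => //.
by apply: SD => //; rewrite -mulN1r; apply: SM.
Qed.

HB.instance Definition _ := GRing.isZmodClosed.Build R gen_mem gen_mem_zmod_closed.

Definition quot_ring : Type := Quotient.quot gen_mem.
HB.instance Definition _ := GRing.Zmodule.on quot_ring.

Local Open Scope quotient_scope.

Definition quot_proj (x : R) : quot_ring := \pi_(Quotient.quot gen_mem) x.

Lemma quot_projP x y : quot_proj x = quot_proj y <-> ideal_gen S (x - y).
Proof.
rewrite /quot_proj; split=> [/eqP|/gen_memP h].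
  by rewrite -Quotient.idealrBE => /gen_memP.
by apply/eqP; rewrite -Quotient.idealrBE.
Qed.

Definition quot_repr (u : quot_ring) : R := repr (u : Quotient.quot gen_mem).

Lemma quot_reprK u : quot_proj (quot_repr u) = u.
Proof. exact: reprK. Qed.

Definition quot_one : quot_ring := quot_proj 1.
Definition quot_mul (u v : quot_ring) : quot_ring :=
  quot_proj (quot_repr u * quot_repr v).

Lemma quot_projM x y : quot_proj (x * y) = quot_mul (quot_proj x) (quot_proj y).
Proof.
have [_ SD SM] := ideal_gen_is_ideal S.
apply/esym/quot_projP; set x' := quot_repr _; set y' := quot_repr _.
have hx : ideal_gen S (x' - x) by apply/quot_projP; rewrite quot_reprK.
have hy : ideal_gen S (y' - y) by apply/quot_projP; rewrite quot_reprK.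
rewrite (_ : _ - _ = x' * (y' - y) + y * (x' - x)); last first.
  by rewrite !mulrBr addrA (mulrC y x') subrK (mulrC y).
by apply: SD; exact: SM.
Qed.

Lemma quot_projD x y : quot_proj (x + y) = quot_proj x + quot_proj y.
Proof. exact: (raddfD (\pi_(Quotient.quot gen_mem))). Qed.

Lemma quot_mulA : associative quot_mul.
Proof.
move=> u v w; rewrite -(quot_reprK u) -(quot_reprK v) -(quot_reprK w).
by rewrite -!quot_projM mulrA.
Qed.

Lemma quot_mulC : commutative quot_mul.
Proof. by move=> u v; rewrite /quot_mul mulrC. Qed.

Lemma quot_mul1 : left_id quot_one quot_mul.
Proof. by move=> u; rewrite -(quot_reprK u) -quot_projM mul1r. Qed.

Lemma quot_mulDl : left_distributive quot_mul +%R.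
Proof.
move=> u v w; rewrite -(quot_reprK u) -(quot_reprK v) -(quot_reprK w).
by rewrite -quot_projD -!quot_projM -quot_projD mulrDl.
Qed.

HB.instance Definition _ := GRing.Zmodule_isComPzRing.Build quot_ring
  quot_mulA quot_mulC quot_mul1 quot_mulDl.

Lemma quot_proj_zmod_morphism : zmod_morphism quot_proj.
Proof. exact: (raddfB (\pi_(Quotient.quot gen_mem))). Qed.

Lemma quot_proj_monoid_morphism : monoid_morphism quot_proj.
Proof. by split=> //; exact: quot_projM. Qed.

HB.instance Definition _ :=
  GRing.isZmodMorphism.Build R quot_ring quot_proj quot_proj_zmod_morphism.
HB.instance Definition _ :=
  GRing.isMonoidMorphism.Build R quot_ring quot_proj quot_proj_monoid_morphism.

End QuotientRing.

Section Zariski.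
Variables (k : fieldType) (t s : nat).

(* Points of k^(ts) are t x s matrices; mxvec lists their coordinates. *)
Definition zariski_closed (Z : set 'M[k]_(t, s)) : Prop :=
  exists F : set {mpoly k[t * s]},
    Z = [set v | forall p, F p -> p.@[fun i => mxvec v 0 i] = 0].

Definition zariski_open (U : set 'M[k]_(t, s)) : Prop := zariski_closed (~` U).

Definition zariski_dense (U : set 'M[k]_(t, s)) : Prop :=
  forall V, zariski_open V -> V !=set0 -> (U `&` V) !=set0.

End Zariski.

Section LocalRings.
Variables (R : comNzRingType) (k : fieldType) (pi : {rmorphism R -> k}).

(* k, together with pi, is the residue field R/m. *)
Definition residue_map (m : set R) : Prop :=
  (forall c : k, exists x, pi x = c) /\ m = [set x | pi x = 0].

(* char R = char k *)
Definition equicharacteristic : Prop :=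
  forall n : nat, n%:R = 0 :> R <-> n%:R = 0 :> k.

Definition for_general t s (a : 'I_s -> R) (P : ('I_t -> R) -> Prop) : Prop :=
  exists U : set 'M[k]_(t, s), [/\ zariski_open U, zariski_dense U
    & forall L : 'M[R]_(t, s), U (map_mx pi L) ->
        P (fun i => \sum_(j < s) L i j * a j)].

(* The defining condition on an ideal I of analytic spread d = dim R, for every
   choice of the generators of I with respect to which elements are general;
   m-primary ideals have analytic spread d.  The index l is that of x_d. *)
Definition j_stretched (d : nat) (I : set R) : Prop :=
  forall s (a : 'I_s -> R), I = ideal_gen (range a) ->
  for_general a (fun x : 'I_d -> R =>
    forall l : 'I_d, l.+1 = d ->
    let J := ideal_gen [set x i | i in [set i : 'I_d | (i < l)%N]] in
    let K := saturation J I in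
    let Ibar : set (quot_ring K) := quot_proj K @` I in
    let xdbar : quot_ring K := quot_proj K (x l) in
    length_le (ideal_pow Ibar 2)
      (ideal_add (ideal_mul (ideal_gen [set xdbar]) Ibar) (ideal_pow Ibar 3)) 1).

End LocalRings.

(* Main.v *)
(* Since [x_1, ..., x_(d-1)] vanish in the quotient by the saturation, it suffices that
   [I^2 / (J I + I^3)] has length at most [1] for general [J = (x_1, ..., x_d)]; this is
   deduced from the same bound for the given minimal reduction [H].

   A minimal reduction [H] has at most [d] generators: by a regular sequence of length [d],
   the length of [R / H^n] is [O(n^d)], so more than [d] generators [y] satisfy
   [p(y) \in H^(e+1)] for a homogeneous [p] of degree [e] with a coefficient [1]. As the
   residue field is infinite, a linear change of the generators makes [p] monic in one of
   them, and the others generate a smaller reduction.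

   Let [w] span [I^2 / (H I + I^3)]. Over the generic [J], Cramer's rule gives [D e = 0]
   modulo [J I + (w)] for [e] in [I^2], with [D] a unit at [H], and turns the relations that
   put [m I^2] inside [H I + I^3] into [D f + T w = 0] modulo [J I + I^3], for [f] in [m I^2],
   with [T = 0] at [H]. Either some [T] is a unit at some [J], and then [I^2 = J I] for
   general [J]; or all coefficients of [T] lie in [m], so that [T w] is a combination of
   the [f], the system in the [f] is invertible for general [J], and [m I^2] lies in
   [J I + I^3]. The dichotomy makes every condition depend on the coefficients of the [x_i]
   modulo [m] only, so no coefficient field is needed. *)

Require Import Defs.
From mathcomp Require Import all_boot all_order all_algebra.
From mathcomp Require Import boolp classical_sets cardinality.
From mathcomp Require Import mpoly ring zify.

Set Implicit Arguments.
Unset Strict Implicit.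
Unset Printing Implicit Defensive.

Import GRing.Theory.
Local Open Scope classical_set_scope.
Local Open Scope ring_scope.

(** * Ideals and primes in noetherian rings *)

Section IdealBasics.
Context {R : comPzRingType}.
Implicit Types (A B C I J X : set R) (x y : R).

Lemma ideal0 A : is_ideal A -> A 0. Proof. by case. Qed.

Lemma idealD A x y : is_ideal A -> A x -> A y -> A (x + y).
Proof. by case=> _ + _; exact. Qed.

Lemma idealMl A x y : is_ideal A -> A y -> A (x * y).
Proof. by case=> _ _; exact. Qed.

Lemma idealMr A x y : is_ideal A -> A x -> A (x * y).
Proof. by move=> ? ?; rewrite mulrC; exact: idealMl. Qed.

Lemma idealN A x : is_ideal A -> A x -> A (- x).
Proof. by move=> iA Ax; rewrite -mulN1r; exact: idealMl. Qed.

Lemma idealB A x y : is_ideal A -> A x -> A y -> A (x - y).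
Proof. by move=> iA Ax Ay; apply: idealD => //; exact: idealN. Qed.

Lemma ideal_sum A (T : Type) (r : seq T) (P : pred T) (F : T -> R) :
  is_ideal A -> (forall i, P i -> A (F i)) -> A (\sum_(i <- r | P i) F i).
Proof. by move=> iA; apply: big_ind; [exact: ideal0|move=> *; exact: idealD]. Qed.

Lemma ideal_full A : is_ideal A -> A 1 -> A = setT.
Proof.
by move=> iA A1; apply/seteqP; split=> // x _; rewrite -(mulr1 x); apply: idealMl.
Qed.

Lemma is_idealT : is_ideal [set: R]. Proof. by []. Qed.

Lemma mem_ideal_gen (S : set R) x : S x -> ideal_gen S x.
Proof. exact: sub_gen_smallest. Qed.

Lemma ideal_gen_min J (S : set R) : is_ideal J -> S `<=` J -> ideal_gen S `<=` J.
Proof. by move=> iJ SJ x; apply. Qed.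

Lemma ideal_gen_rangeP n (a : 'I_n -> R) x :
  ideal_gen (range a) x <-> exists r : 'I_n -> R, x = \sum_i r i * a i.
Proof.
have gI := ideal_gen_is_ideal (range a).
split=> [|[r ->]]; last first.
  by apply: ideal_sum => // i _; apply: (idealMl _ gI); apply: mem_ideal_gen; exists i.
apply: (@ideal_gen_min [set x | exists r : 'I_n -> R, x = \sum_i r i * a i]).
  split=> [|y z [r ->] [s ->]|y z [r ->]].
  - by exists (fun=> 0); rewrite big1 // => i _; rewrite mul0r.
  - exists (fun i => r i + s i); rewrite -big_split.
    by apply: eq_bigr => i _; rewrite mulrDl.
  - by exists (fun i => y * r i); rewrite mulr_sumr; apply: eq_bigr => i _; rewrite mulrA.
move=> _ [i _ <-]; exists (fun j => (j == i)%:R).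
by rewrite (bigD1 i) //= eqxx mul1r big1 ?addr0 // => j /negPf ->; rewrite mul0r.
Qed.

Lemma mem_range_gen n (a : 'I_n -> R) i : ideal_gen (range a) (a i).
Proof. by apply: mem_ideal_gen; exists i. Qed.

Lemma ideal_mul_ideal A B : is_ideal (ideal_mul A B).
Proof. exact: ideal_gen_is_ideal. Qed.

Lemma mem_ideal_mul A B x y : A x -> B y -> ideal_mul A B (x * y).
Proof. by move=> Ax By; apply: mem_ideal_gen; exists x => //; exists y. Qed.

Lemma ideal_mul_min A B X : is_ideal X -> (forall x y, A x -> B y -> X (x * y)) ->
  ideal_mul A B `<=` X.
Proof. by move=> iX h; apply: ideal_gen_min => // _ [x Ax [y By <-]]; exact: h. Qed.

Lemma ideal_mulS A B A' B' : A `<=` A' -> B `<=` B' ->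
  ideal_mul A B `<=` ideal_mul A' B'.
Proof.
move=> sA sB; apply: ideal_mul_min; first exact: ideal_mul_ideal.
by move=> x y /sA ? /sB ?; exact: mem_ideal_mul.
Qed.

Lemma ideal_mulC A B : ideal_mul A B = ideal_mul B A.
Proof.
by apply/seteqP; split; apply: ideal_mul_min; try exact: ideal_mul_ideal;
  move=> x y ? ?; rewrite mulrC; exact: mem_ideal_mul.
Qed.

Lemma ideal_mul_subl A B : is_ideal A -> ideal_mul A B `<=` A.
Proof. by move=> iA; apply: ideal_mul_min => // x y Ax _; exact: idealMr. Qed.

Lemma ideal_mul_subr A B : is_ideal B -> ideal_mul A B `<=` B.
Proof. by rewrite ideal_mulC; exact: ideal_mul_subl. Qed.

Lemma ideal_mulA A B C : ideal_mul A (ideal_mul B C) = ideal_mul (ideal_mul A B) C.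
Proof.
have half A' B' C' :
    ideal_mul A' (ideal_mul B' C') `<=` ideal_mul (ideal_mul A' B') C'.
  set X := ideal_mul (ideal_mul _ _) _; have iX : is_ideal X by exact: ideal_mul_ideal.
  apply: (ideal_mul_min iX) => x y A'x.
  have : ideal_mul B' C' `<=` [set y | X (x * y)].
    apply: ideal_mul_min; first split=> /=.
    - by rewrite mulr0; exact: ideal0.
    - by move=> u v ? ?; rewrite mulrDr; exact: (idealD iX).
    - by move=> u v ?; rewrite mulrCA; exact: (idealMl _ iX).
    - by move=> u v ? ? /=; rewrite mulrA; apply: mem_ideal_mul => //; exact: mem_ideal_mul.
  by apply.
apply/seteqP; split; first exact: half.
rewrite (ideal_mulC (ideal_mul A B)) (ideal_mulC A B).
by rewrite (ideal_mulC A (ideal_mul B C)) (ideal_mulC B C); exact: half.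
Qed.

Lemma ideal_mulT A : is_ideal A -> ideal_mul A setT = A.
Proof.
move=> iA; apply/seteqP; split; first exact: ideal_mul_subl.
by move=> x Ax; rewrite -(mulr1 x); exact: mem_ideal_mul.
Qed.

Lemma ideal_pow_ideal I n : is_ideal (ideal_pow I n).
Proof. by case: n => [|n] /=; [exact: is_idealT|exact: ideal_mul_ideal]. Qed.

Lemma ideal_pow1 I : is_ideal I -> ideal_pow I 1 = I.
Proof. by move=> iI /=; rewrite ideal_mulC ideal_mulT. Qed.

Lemma ideal_pow2 I : is_ideal I -> ideal_pow I 2 = ideal_mul I I.
Proof. by move=> iI; have /= := ideal_pow1 iI => ->. Qed.

Lemma ideal_powD I i j :
  ideal_pow I (i + j) = ideal_mul (ideal_pow I i) (ideal_pow I j).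
Proof.
elim: j => [|j ih]; first by rewrite addn0 ideal_mulT //; exact: ideal_pow_ideal.
by rewrite addnS /= ih ideal_mulA.
Qed.

Lemma ideal_pow_le I i j : (i <= j)%N -> ideal_pow I j `<=` ideal_pow I i.
Proof.
move=> /subnKC <-; rewrite ideal_powD.
by apply: ideal_mul_subl; exact: ideal_pow_ideal.
Qed.

Lemma mem_ideal_pow I x n : I x -> ideal_pow I n (x ^+ n).
Proof. by move=> Ix; elim: n => //= n ih; rewrite exprSr; exact: mem_ideal_mul. Qed.

Lemma ideal_add_ideal A B : is_ideal A -> is_ideal B -> is_ideal (ideal_add A B).
Proof.
move=> iA iB; split.
- exists 0; first exact: ideal0.
  by exists 0; [exact: ideal0|rewrite addr0].
- move=> _ _ [a Aa [b Bb <-]] [a' Aa' [b' Bb' <-]].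
  exists (a + a'); first exact: idealD.
  by exists (b + b'); [exact: idealD|rewrite addrACA].
- move=> x _ [a Aa [b Bb <-]].
  exists (x * a); first exact: idealMl.
  by exists (x * b); [exact: idealMl|rewrite mulrDr].
Qed.

Lemma ideal_add_subl A B : is_ideal B -> A `<=` ideal_add A B.
Proof. by move=> iB x Ax; exists x => //; exists 0; [exact: ideal0|rewrite addr0]. Qed.

Lemma ideal_add_subr A B : is_ideal A -> B `<=` ideal_add A B.
Proof. by move=> iA x Bx; exists 0; [exact: ideal0|exists x; rewrite ?add0r]. Qed.

Lemma ideal_add_min A B X : is_ideal X -> A `<=` X -> B `<=` X -> ideal_add A B `<=` X.
Proof. by move=> iX AX BX _ [a /AX ? [b /BX ? <-]]; exact: idealD. Qed.

Lemma bigcup_chain_ideal (F : set (set R)) : F !=set0 ->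
  (forall X, F X -> is_ideal X) -> total_on F subset ->
  is_ideal (\bigcup_(X in F) X).
Proof.
move=> [X0 FX0] iF tF; split=> [|x y [X FX Xx] [Y FY Yy]|x y [X FX Xx]].
- by exists X0 => //; apply: ideal0; exact: iF.
- by case: (tF _ _ FX FY) => h; [exists Y|exists X] => //; apply: idealD;
    by [exact: iF|exact: h|].
- by exists X => //; apply: idealMl => //; exact: iF.
Qed.

(* [A + (x)] *)
Definition adjoin A x : set R := [set y | exists r, A (y - r * x)].

Lemma adjoin_ideal A x : is_ideal A -> is_ideal (adjoin A x).
Proof.
move=> iA; split=> [|y z [r Ar] [s As]|y z [r Ar]].
- by exists 0; rewrite mul0r subr0; exact: ideal0.
- by exists (r + s); rewrite mulrDl opprD addrACA; exact: idealD.
- by exists (y * r); rewrite -mulrA -mulrBr; exact: idealMl.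
Qed.

Lemma adjoin_sub A x : A `<=` adjoin A x.
Proof. by move=> y Ay; exists 0; rewrite mul0r subr0. Qed.

Lemma mem_adjoin A x : is_ideal A -> adjoin A x x.
Proof. by move=> iA; exists 1; rewrite mul1r subrr; exact: ideal0. Qed.

Lemma adjoin_min A x X : is_ideal X -> A `<=` X -> X x -> adjoin A x `<=` X.
Proof.
move=> iX AX Xx y [r /AX Xr]; rewrite -(subrK (r * x) y).
by apply: idealD => //; exact: idealMl.
Qed.

Lemma adjoinS A B x : A `<=` B -> adjoin A x `<=` adjoin B x.
Proof. by move=> AB y [r /AB]; exists r. Qed.

Lemma adjoin_proper A x : is_ideal A -> ~ A x -> A `<` adjoin A x.
Proof.
by move=> iA nAx; split=> [|/(_ x (mem_adjoin x iA))//]; exact: adjoin_sub.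
Qed.

Lemma adjoin_mul A x y u v : is_ideal A -> A (x * y) ->
  adjoin A x u -> adjoin A y v -> A (u * v).
Proof.
move=> iA Axy [r Ar] [s As].
rewrite -(subrK (r * x) u) mulrDl; apply: idealD => //; first exact: idealMr.
rewrite -(subrK (s * y) v) mulrDr; apply: idealD => //; first exact: idealMl.
by rewrite mulrACA; exact: idealMl.
Qed.

End IdealBasics.

Section Noetherian.
Context {R : comNzRingType}.
Implicit Types (A B I P Q m : set R) (x y : R).

(** Zorn's lemma applied to the counterexamples: the union of a chain of ideals is finitely
    generated, hence equal to a member of the chain, so there would be a maximal counterexample. *)
Lemma noetherian_ind (G : set R -> Prop) : noetherian R ->
  (forall A, is_ideal A -> (forall B, is_ideal B -> A `<` B -> G B) -> G A) ->
  forall A, is_ideal A -> G A.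
Proof.
move=> noeth step A iA; apply: contrapT => nGA.
pose P := [set X | X = set0 \/ is_ideal X /\ ~ G X].
have [|M [PM maxM]] := @Zorn_bigcup R P.
  move=> F FP tF; have [[Y FY Y0]|allempty] := pselect (exists2 Y, F Y & Y <> set0).
  - right; pose F' := F `&` [set X | is_ideal X].
    have eU : \bigcup_(X in F) X = \bigcup_(X in F') X.
      apply/seteqP; split=> x [X]; last by case=> FX _ Xx; exists X.
      by move=> FX Xx; exists X => //; split=> //; case: (FP _ FX) Xx => [->|[]].
    have F'0 : F' !=set0 by exists Y; split=> //; case: (FP _ FY) => [/Y0|[]].
    have tF' : total_on F' subset by move=> X Z [? _] [? _]; exact: tF.
    have iU : is_ideal (\bigcup_(X in F') X).
      by apply: bigcup_chain_ideal => // X [].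
    have [n [a eUa]] := noeth _ iU.
    have [X [FX aX]] : exists X, F' X /\ forall i, X (a i).
      have : forall i, exists X, F' X /\ X (a i).
        by move=> i; have := mem_range_gen (a := a) i; rewrite -eUa => -[X F'X Xa]; exists X.
      move=> /choice [f fP].
      have : forall s : seq 'I_n, exists X, F' X /\ forall i, i \in s -> X (a i).
        elim=> [|i s [X [FX Xs]]]; first by case: F'0 => X; exists X.
        have [Fi fi] := fP i; case: (tF' _ _ FX Fi) => h.
        + exists (f i); split=> // j; rewrite inE => /predU1P [->//|/Xs /h//].
        + by exists X; split=> // j; rewrite inE => /predU1P [->|/Xs//]; exact: h.
      move=> /(_ (enum 'I_n)) [X [FX Xs]]; exists X; split=> // i.
      by apply: Xs; rewrite mem_enum.
    rewrite eU; suff <- : X = \bigcup_(X in F') X.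
      have [FX' iX] := FX; split=> //.
      case: (FP _ FX') => [X0|[]//]; exfalso.
      by move: (ideal0 iX); rewrite X0.
    apply/seteqP; split=> [x Xx|]; first by exists X.
    rewrite eUa; apply: ideal_gen_min; first by case: FX.
    by move=> _ [i _ <-].
  - left; apply/seteqP; split=> // x [X FX Xx]; apply: allempty; exists X => //.
    by move=> X0; rewrite X0 in Xx.
case: PM => [M0|[iM nGM]].
  have /maxM : M `<` A; last by apply; right.
  by rewrite M0; split=> // /(_ 0 (ideal0 iA)).
by apply: nGM; apply: step => // B iB /maxM nPB; apply: contrapT => nGB; apply: nPB; right.
Qed.

Lemma adjoin_neqT_prime A : is_ideal A -> ~ A 1 -> ~ prime_ideal A ->
  exists x y, [/\ ~ A x, ~ A y & A (x * y)].
Proof.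
move=> iA A1 nP; apply: contrapT => h; apply: nP; split=> // x y Axy.
by have [|nx] := pselect (A x); [left|right]; apply: contrapT => ny; apply: h; exists x, y.
Qed.

(** Noetherian induction: if [x y] lies in [A] while [x] and [y] do not, then powers of [m] lie in
    [A + (x)] and in [A + (y)], and the product of these two ideals lies in [A]. *)
Lemma primes_eq_pow_sub A m : noetherian R -> is_ideal A ->
  (forall P, prime_ideal P -> A `<=` P -> P = m) -> exists n, ideal_pow m n `<=` A.
Proof.
move=> noeth; move: A; apply: (noetherian_ind (G := fun A =>
  (forall P, prime_ideal P -> A `<=` P -> P = m) -> exists n, ideal_pow m n `<=` A) noeth).
move=> A iA ih hA; have [A1|A1] := pselect (A 1).
  by exists 0; rewrite (ideal_full iA A1).
have [pA|npA] := pselect (prime_ideal A).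
  by exists 1; rewrite -(hA A) // ideal_pow1.
have [x [y [nx ny xy]]] := adjoin_neqT_prime iA A1 npA.
have ih' z : ~ A z -> exists n, ideal_pow m n `<=` adjoin A z.
  move=> nz; apply: ih; [exact: adjoin_ideal|exact: adjoin_proper|].
  by move=> P pP AP; apply: hA => //; apply: subset_trans AP; exact: adjoin_sub.
have [[i hi] [j hj]] := (ih' _ nx, ih' _ ny).
exists (i + j); rewrite ideal_powD; apply: ideal_mul_min => // u v /hi ? /hj ?.
exact: adjoin_mul xy _ _.
Qed.

(* The elements of [R] outside [P] invert in the localization at [P], where [x] is
   nilpotent modulo [A] as it lies in every prime over [A]. *)
Lemma primes_mem_pow A P x : noetherian R -> is_ideal A -> prime_ideal P ->
  (forall Q, prime_ideal Q -> A `<=` Q -> Q `<=` P -> Q x) ->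
  exists u n, ~ P u /\ A (x ^+ n * u).
Proof.
move=> noeth iA pP; have [iP P1 PM] := pP; move: A iA.
apply: (noetherian_ind (G := fun A =>
  (forall Q, prime_ideal Q -> A `<=` Q -> Q `<=` P -> Q x) ->
  exists u n, ~ P u /\ A (x ^+ n * u)) noeth) => A iA ih hA.
have [A1|A1] := pselect (A 1).
  by exists 1, 0; rewrite mul1r.
have [pA|npA] := pselect (prime_ideal A).
  have [AP|/existsNP [u /not_implyP [Au nPu]]] := pselect (A `<=` P).
    by exists 1, 1; rewrite mulr1; split=> //; exact: hA.
  by exists u, 0; rewrite mul1r.
have [y [z [ny nz yz]]] := adjoin_neqT_prime iA A1 npA.
have ih' t : ~ A t -> exists u n, ~ P u /\ adjoin A t (x ^+ n * u).
  move=> nt; apply: ih; [exact: adjoin_ideal|exact: adjoin_proper|].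
  by move=> Q pQ AQ; apply: hA => //; apply: subset_trans AQ; exact: adjoin_sub.
have [[u [i [nPu hu]]] [v [j [nPv hv]]]] := (ih' _ ny, ih' _ nz).
exists (u * v), (i + j)%N; split; first by move=> /PM [].
by rewrite exprD mulrACA; exact: adjoin_mul yz _ _.
Qed.

End Noetherian.

(** * Zariski open sets over an infinite field *)

Section InfiniteField.
Context {k : fieldType}.
Hypothesis k_infinite : infinite_set [set: k].

Lemma poly_nonroot (p : {poly k}) : p != 0 -> exists x, p.[x] != 0.
Proof.
move=> p0; have [B _ Bp] := infinite_set_fset (size p) k_infinite.
apply: contrapT => h; have : all (root p) (finmap.enum_fset B).
  by apply/allP => x _; apply: contrapT => /negP nr; apply: h; exists x.
by move=> /(max_poly_roots p0) /(_ (finmap.fset_uniq B)); rewrite ltnNge Bp.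
Qed.

(** Induction on the number of variables: [muni] makes [p] univariate in the last variable, and a
    point where one of its coefficients is nonzero leaves a nonzero univariate polynomial. *)
Lemma mpoly_nonroot n (p : {mpoly k[n]}) : p != 0 -> exists v, p.@[v] != 0.
Proof.
elim: n p => [|n ih] p p0.
  exists (fun=> 0); have [c pc] : exists c, p = c%:MP_[0].
    exists (p@_0%MM); apply/mpolyP => m; rewrite mcoeffC.
    have -> : m = 0%MM by apply/mnmP => -[].
    by rewrite eqxx mulr1.
  by move: p0; rewrite pc mevalC mpolyC_eq0.
have [m pm] : exists m, p@_m != 0.
  apply: contrapT => h; move/eqP: p0; apply; apply/mpolyP => m; rewrite mcoeff0.
  by apply/eqP; apply: contrapT => /negP pm; apply: h; exists m.
pose rest (m : 'X_{1..n.+1}) : 'X_{1..n} := [multinom m (widen_ord (leqnSn n) i) | i < n].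
have rest_inj m1 m2 : rest m1 = rest m2 -> m1 ord_max = m2 ord_max -> m1 = m2.
  move=> /mnmP e1 e2; apply/mnmP => i; have [j ->|->//] := unliftP ord_max i.
  have := e1 j; rewrite !mnmE.
  by have -> : widen_ord (leqnSn n) j = lift ord_max j
    by apply/val_inj; rewrite /= /bump leqNgt ltn_ord.
have cm : (muni p)`_(m ord_max) @_ (rest m) = p@_m.
  rewrite muniE coef_sum raddf_sum /=.
  have [ms|mns] := boolP (m \in msupp p); last first.
    move: mns; rewrite mcoeff_msupp negbK => /eqP e.
    by rewrite e eqxx in pm.
  rewrite (bigD1_seq m) ?msupp_uniq //= big1 ?addr0 => [|m' m'm].
    by rewrite coefZ coefXn eqxx mulr1 mcoeffZ mcoeffX eqxx mulr1.
  rewrite coefZ coefXn; case: eqP => [e|]; last by rewrite mulr0 mcoeff0.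
  rewrite mulr1 mcoeffZ mcoeffX; case: eqP => [e'|]; last by rewrite mulr0.
  by move/eqP: m'm; case; apply: rest_inj.
have [v qv] : exists v, ((muni p)`_(m ord_max)).@[v] != 0.
  by apply: ih; apply: contraNneq pm => q0; rewrite -cm q0 mcoeff0.
pose P := map_poly (meval v) (muni p).
have P0 : P != 0.
  apply: contraNneq qv => P0.
  by have := coef_map (meval v) (muni p) (m ord_max); rewrite -/P P0 coef0 => <-.
have [t Pt] := poly_nonroot P0.
exists (fun i => if unlift ord_max i is Some j then v j else t).
suff -> : p.@[fun i => if unlift ord_max i is Some j then v j else t] = P.[t] by [].
rewrite /P muniE rmorph_sum /= horner_sum mevalE; apply: eq_bigr => m' _.
rewrite map_polyZ /= mevalZ mevalX map_polyXn hornerZ hornerXn -mulrA.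
congr (_ * _); rewrite big_ord_recr /= unlift_none; congr (_ * _).
apply: eq_bigr => j _; rewrite mnmE.
have -> : widen_ord (leqnSn n) j = lift ord_max j.
  by apply/val_inj; rewrite /= /bump leqNgt ltn_ord.
by rewrite liftK.
Qed.

Lemma principal_zariski_open t s (D : {mpoly k[t * s]}) :
  zariski_open [set v : 'M[k]_(t, s) | D.@[fun i => mxvec v 0 i] != 0].
Proof.
exists [set D]; apply/seteqP; split=> v /=.
  by move=> /negP; rewrite negbK => /eqP Dv p ->.
by move=> /(_ D erefl) ->; rewrite eqxx.
Qed.

(** Some equation [p] of the complement of a nonempty open [V] is a nonzero polynomial; a point
    where [D * p] does not vanish lies in both sets. *)
Lemma principal_zariski_dense t s (D : {mpoly k[t * s]}) : D != 0 ->
  zariski_dense [set v : 'M[k]_(t, s) | D.@[fun i => mxvec v 0 i] != 0].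
Proof.
move=> D0 V [F VF] [v Vv].
have [p Fp pv] : exists2 p, F p & p.@[fun i => mxvec v 0 i] != 0.
  apply: contrapT => h; suff : (~` V) v by apply.
  rewrite VF => p Fp; apply/eqP; apply: contrapT => /negP pv.
  by apply: h; exists p.
have Dp0 : D * p != 0.
  by rewrite mulf_neq0 //; apply: contraNneq pv => ->; rewrite meval0.
have [w] := mpoly_nonroot Dp0; rewrite mevalM mulf_eq0 negb_or => /andP [Dw pw].
have ew (q : {mpoly k[t * s]}) :
    q.@[fun i => mxvec (vec_mx (\row_i w i) : 'M_(t, s)) 0 i] = q.@[w].
  by apply: meval_eq => i; rewrite vec_mxK mxE.
exists (vec_mx (\row_i w i)); split; first by rewrite /= ew.
apply: contrapT => nV; have : (~` V) (vec_mx (\row_i w i)) by [].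
by rewrite VF => /(_ p Fp); rewrite ew => /eqP; rewrite (negPf pw).
Qed.

End InfiniteField.

(** * Perturbation of generators *)

Section Perturbation.
Context {R : comNzRingType} {k : fieldType} (pi : {rmorphism R -> k}).
Variable m : set R.
Hypotheses (R_noeth : noetherian R) (k_infinite : infinite_set [set: k]).
Hypotheses (m_ideal : is_ideal m) (mE : m = [set x | pi x = 0]).
Hypothesis pi_surj : forall c : k, exists x, pi x = c.
Hypothesis pi_unit : forall x, pi x != 0 -> exists y, y * x = 1.

Lemma local_cancel (X : set R) x y : is_ideal X -> pi x != 0 -> X (x * y) -> X y.
Proof.
move=> iX /pi_unit [z zx] Xxy; rewrite -(mul1r y) -zx -mulrA.
exact: (idealMl _ iX).
Qed.

(** Generators are kept as a column, so that relations between them become matrix equations. *)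
Definition colgen n (e : 'cV[R]_n) : set R := ideal_gen (range (fun i => e i 0)).

Lemma colgen_ideal n (e : 'cV[R]_n) : is_ideal (colgen e).
Proof. exact: ideal_gen_is_ideal. Qed.

Lemma mem_colgen n (e : 'cV[R]_n) i : colgen e (e i 0).
Proof. by apply: mem_ideal_gen; exists i. Qed.

Lemma colgenP n (e : 'cV[R]_n) x :
  colgen e x <-> exists r : 'rV_n, x = (r *m e) 0 0.
Proof.
rewrite /colgen ideal_gen_rangeP; split=> [[r ->]|[r ->]].
  by exists (\row_i r i); rewrite mxE; apply: eq_bigr => i _; rewrite mxE.
by exists (r 0); rewrite mxE.
Qed.

Lemma colgen_mulmx n p (e : 'cV[R]_n) (x : 'cV[R]_p) :
  (forall i, colgen e (x i 0)) -> exists M, x = M *m e.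
Proof.
move=> h; have /choice [r rP] : forall i, exists r : 'rV_n, x i 0 = (r *m e) 0 0.
  by move=> i; apply/colgenP.
exists (\matrix_i r i); apply/matrixP => i j.
by rewrite (ord1 j) rP !mxE; apply: eq_bigr => l _; rewrite !mxE.
Qed.

Lemma colgen_sub n (e : 'cV[R]_n) (X : set R) :
  is_ideal X -> (forall i, X (e i 0)) -> colgen e `<=` X.
Proof. by move=> iX eX; apply: ideal_gen_min => // _ [i _ <-]. Qed.

Lemma mulmx_ideal n p (e : 'cV[R]_n) (M : 'M_(p, n)) (X : set R) i :
  is_ideal X -> (forall j, X (e j 0)) -> X ((M *m e) i 0).
Proof. by move=> iX eX; rewrite mxE; apply: ideal_sum => // j _; apply: (idealMl _ iX). Qed.

Lemma ideal_mul_colgenP n (e : 'cV[R]_n) x :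
  ideal_mul m (colgen e) x <->
  exists2 r : 'rV_n, (forall i, m (r 0 i)) & x = (r *m e) 0 0.
Proof.
split=> [|[r mr ->]]; last first.
  rewrite mxE; apply: ideal_sum => [|i _]; first exact: ideal_mul_ideal.
  by apply: mem_ideal_mul => //; exact: mem_ideal_gen.
apply: (@ideal_mul_min _ _ _ [set x | exists2 r : 'rV_n,
    (forall i, m (r 0 i)) & x = (r *m e) 0 0]).
  split=> [|x1 x2 [r1 h1 ->] [r2 h2 ->]|x1 x2 [r h ->]].
  - by exists 0 => [i|]; rewrite ?mul0mx mxE //; exact: ideal0.
  - exists (r1 + r2) => [i|]; last by rewrite mulmxDl [in RHS]mxE.
    by rewrite mxE; exact: (idealD m_ideal).
  - exists (x1 *: r) => [i|]; last by rewrite -scalemxAl [in RHS]mxE.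
    by rewrite mxE; exact: (idealMl _ m_ideal).
move=> u x1 mu /colgenP [r ->]; exists (u *: r) => [i|].
  by rewrite mxE; exact: (idealMr _ m_ideal).
by rewrite -scalemxAl [in RHS]mxE.
Qed.

Lemma ideal_mul_colgen_mulmx n p (e : 'cV[R]_n) (x : 'cV[R]_p) :
  (forall i, ideal_mul m (colgen e) (x i 0)) ->
  exists2 M : 'M_(p, n), (forall i j, m (M i j)) & x = M *m e.
Proof.
move=> h; have /choice [r rP] : forall i, exists r : 'rV_n,
    (forall j, m (r 0 j)) /\ x i 0 = (r *m e) 0 0.
  by move=> i; have /ideal_mul_colgenP [r mr xr] := h i; exists r.
exists (\matrix_i r i) => [i j|]; first by rewrite mxE; have [] := rP i.
apply/matrixP => i j; rewrite (ord1 j) (proj2 (rP i)) !mxE.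
by apply: eq_bigr => l _; rewrite !mxE.
Qed.

(** * Polynomial families of matrices and their specializations *)

Section Family.
Context {N : nat}.
Implicit Types l : 'I_N -> R.
Local Notation ev l := (map_mx (meval l)).
Local Notation cst := (map_mx (@mpolyC N R)).

Lemma ev_cst l p q (M : 'M[R]_(p, q)) : ev l (cst M) = M.
Proof. by apply/matrixP => i j; rewrite !mxE mevalC. Qed.

(** Whether [p.@[l]] is a unit thus depends on [l] modulo [m] only, through a polynomial over
    [k]. *)
Lemma meval_map_pi l (p : {mpoly R[N]}) :
  (map_mpoly pi p).@[fun i => pi (l i)] = pi p.@[l].
Proof.
elim/mpolyind: p => [|c a p _ _ ih]; first by rewrite !rmorph0.
rewrite !rmorphD /= ih map_mpolyZ map_mpolyX !mevalZ !mevalX rmorphM rmorph_prod.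
by congr (_ * _ + _); apply: eq_bigr => i _; rewrite rmorphXn.
Qed.

Lemma det_scaled_inverse n p (E : 'M[R]_n) (e f : 'M[R]_(n, p)) :
  E *m e = f -> \det E *: e = \adj E *m f.
Proof. by move=> <-; rewrite mulmxA mul_adj_mx mul_scalar_mx. Qed.

Lemma det_unipotent n (M : 'M[R]_n) : (forall i j, m (M i j)) -> pi (\det (1%:M - M)) = 1.
Proof.
move=> mM; rewrite -det_map_mx -[RHS](det1 _ n); congr (\det _).
apply/matrixP => i j; rewrite !mxE rmorphB rmorph_nat.
by have := mM i j; rewrite mE /= => ->; rewrite subr0.
Qed.

(** The determinant trick: [(1 - M) e] has entries in [X] for some matrix [M] over [m], and
    [det (1 - M)] is a unit. *)
Lemma nakayama n (e : 'cV[R]_n) (X : set R) : is_ideal X ->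
  colgen e `<=` ideal_add X (ideal_mul m (colgen e)) -> colgen e `<=` X.
Proof.
move=> iX h.
have /choice [x xP] : forall i, exists x, X x /\ ideal_mul m (colgen e) (e i 0 - x).
  move=> i; have [x Xx [y my <-]] := h _ (mem_colgen (e := e) i).
  by exists x; rewrite addrAC subrr add0r.
have [|M mM eM] := @ideal_mul_colgen_mulmx _ _ e (e - \col_i x i).
  by move=> i; rewrite !mxE; have [] := xP i.
have /det_scaled_inverse dE : (1%:M - M) *m e = \col_i x i.
  by rewrite mulmxBl mul1mx -eM opprB addrC subrK.
apply: colgen_sub => // i; apply: (@local_cancel _ (\det (1%:M - M))) => //.
  by rewrite det_unipotent ?oner_eq0.
have /matrixP /(_ i 0) := dE; rewrite mxE => ->.
by apply: mulmx_ideal => // j; rewrite mxE; have [] := xP j.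
Qed.

(* Cramer's rule along a family [C] of matrices that solves [e] modulo [m] at [l0]. *)
Lemma cramer_family n q (e : 'cV[R]_n) (C : 'M[{mpoly R[N]}]_(q, n)) l0
    (r : 'M_(n, q)) (s : 'cV_n) w (M : 'M_n) :
  (forall i j, m (M i j)) -> e = r *m (ev l0 C *m e) + w *: s + M *m e ->
  exists (D : {mpoly R[N]}) (A : 'M_(n, q)) (S : 'cV_n),
    pi D.@[l0] = 1 /\
    forall l, D.@[l] *: e = ev l A *m (ev l C *m e) + w *: ev l S.
Proof.
move=> mM eE.
(* At [l0] this is [1 - M], whose determinant is [1] modulo [m]; at every [l] it sends [e] to
   [r C(l) e + w s]. *)
pose E := 1%:M - cst M + cst r *m (C - cst (ev l0 C)).
have evE l : ev l E = 1%:M - M + r *m (ev l C - ev l0 C).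
  by rewrite map_mxD map_mxB map_mx1 map_mxM map_mxB !ev_cst.
exists (\det E), (\adj E *m cst r), (\adj E *m cst s); split=> [|l].
  by rewrite -det_map_mx evE subrr mulmx0 addr0 det_unipotent.
rewrite -det_map_mx.
have /det_scaled_inverse -> : ev l E *m e = r *m (ev l C *m e) + w *: s.
  rewrite evE mulmxDl mulmxBl mul1mx {1}eE -mulmxA mulmxBl mulmxBr.
  by rewrite addrK addrC addrA subrK.
by rewrite !map_mxM map_mx_adj !ev_cst mulmxDr -scalemxAr -mulmxA.
Qed.

(* [A / (V + Y)] is zero or isomorphic to the residue field. *)
Definition length_one (A V Y : set R) : Prop := exists w,
  [/\ A w, A `<=` adjoin (ideal_add V Y) w & ideal_mul m A `<=` ideal_add V Y].

(** Length at most one spreads from [l0] to general [l]. In the application [e] generates [I^2], the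
    ideal of [C(l) e] is [J I] for the [J] with coefficients [l], [Y] is [I^3], and [l0] gives
    [H]. *)
Lemma generic_length_one n q (e : 'cV[R]_n) (C : 'M[{mpoly R[N]}]_(q, n)) l0
    (Y : set R) :
  is_ideal Y -> Y `<=` ideal_mul m (colgen e) ->
  length_one (colgen e) (colgen (ev l0 C *m e)) Y ->
  exists2 D : {mpoly k[N]}, D != 0 & forall l, D.@[fun i => pi (l i)] != 0 ->
    length_one (colgen e) (colgen (ev l C *m e)) Y.
Proof.
move=> iY YmA [w [Aw AV mAV]].
set A := colgen e in YmA Aw AV mAV *; have iA : is_ideal A by exact: colgen_ideal.
set mA := ideal_mul m A in YmA mAV; have imA : is_ideal mA by exact: ideal_mul_ideal.
pose V l := colgen (ev l C *m e).
have iV l : is_ideal (V l) by exact: colgen_ideal.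
have iVY l : is_ideal (ideal_add (V l) Y) by exact: ideal_add_ideal.
have nonzero (D : {mpoly R[N]}) : pi D.@[l0] = 1 -> map_mpoly pi D != 0.
  move=> D1; apply: (contra_neq (z1 := 1%R : k) (z2 := 0)) (oner_neq0 k) => D0.
  by rewrite -D1 -meval_map_pi D0 meval0.
(* At [l0] each [e_i] is [s_i w + v_i] up to an element of [Y], which lies in [m A]; Cramer's rule
   extends this relation to all [l]. *)
have [D [B [S [D1 DE]]]] : exists (D : {mpoly R[N]}) (B : 'M_(n, q)) (S : 'cV_n),
    pi D.@[l0] = 1 /\
    forall l, D.@[l] *: e = ev l B *m (ev l C *m e) + w *: ev l S.
  have /choice [s sP] : forall i, exists s, ideal_add (V l0) Y (e i 0 - s * w).
    by move=> i; apply: AV; exact: (mem_colgen _).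
  have /choice [v vP] : forall i, exists v, V l0 v /\ Y (e i 0 - s i * w - v).
    by move=> i; have [v Vv [y Yy <-]] := sP i; exists v; rewrite addrAC subrr add0r.
  have [|r rE] := @colgen_mulmx _ _ (ev l0 C *m e) (\col_i v i).
    by move=> i; rewrite mxE; have [] := vP i.
  have [|M mM ME] := @ideal_mul_colgen_mulmx _ _ e (\col_i (e i 0 - s i * w - v i)).
    by move=> i; rewrite mxE; apply: YmA; have [] := vP i.
  apply: (@cramer_family _ _ e C l0 r (\col_i s i) w M) => //.
  rewrite -rE -ME; apply/matrixP => i j; rewrite !mxE (ord1 j).
  by ring.
have [p [f fE]] : exists p (f : 'cV[R]_p), mA = colgen f.
  have [p [a aE]] := R_noeth imA; exists p, (\col_i a i); rewrite aE /colgen.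
  suff -> : (fun i => (\col_i a i) i 0) = a by [].
  by apply/funext => i; rewrite mxE.
have mAf u : mA (f u 0) by rewrite fE; exact: (mem_colgen _).
have [b [y [Yy fb]]] : exists (b : 'M_(p, q)) (y : 'cV_p),
    (forall u, Y (y u 0)) /\ f - y = b *m (ev l0 C *m e).
  have /choice [v vP] : forall u, exists v, V l0 v /\ Y (f u 0 - v).
    move=> u; have [v Vv [z Yz <-]] := mAV _ (mAf u).
    by exists v; rewrite addrAC subrr add0r.
  have [|b bE] := @colgen_mulmx _ _ (ev l0 C *m e) (\col_u v u).
    by move=> u; rewrite mxE; have [] := vP u.
  exists b, (\col_u (f u 0 - v u)); split=> [u|]; first by rewrite mxE; have [] := vP u.
  by rewrite -bE; apply/matrixP => u j; rewrite !mxE (ord1 j) opprB addrCA subrr addr0.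
pose T := cst b *m (C - cst (ev l0 C)) *m S.
have evT l : ev l T = b *m (ev l C - ev l0 C) *m ev l S.
  by rewrite !map_mxM map_mxB !ev_cst.
(* Deforming the relation [f - y = b C(l0) e] and clearing the error through
   [D e = B C e + w S] leaves a multiple of [w] that vanishes at [l0]. *)
have VT l u : V l (D.@[l] * (f u 0 - y u 0) + w * (T u 0).@[l]).
  have -> : D.@[l] * (f u 0 - y u 0) + w * (T u 0).@[l] =
      ((D.@[l] *: b - b *m (ev l C - ev l0 C) *m ev l B) *m (ev l C *m e)) u 0.
    suff <- : D.@[l] *: (f - y) + w *: ev l T =
      (D.@[l] *: b - b *m (ev l C - ev l0 C) *m ev l B) *m (ev l C *m e) by rewrite !mxE.
    rewrite evT scalemxAr; set X := b *m (ev l C - ev l0 C).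
    have -> : w *: ev l S = D.@[l] *: e - ev l B *m (ev l C *m e).
      by rewrite DE addrC addKr.
    rewrite mulmxBr mulmxBl addrA -[X *m _ *m _]mulmxA -scalemxAl -scalemxAr.
    congr (_ - _); rewrite fb -scalerDr; congr (_ *: _).
    by rewrite /X -mulmxA -mulmxDr mulmxBl addrC subrK.
  by apply: mulmx_ideal => // j; exact: (mem_colgen _).
clearbody T; have [[u [a Ta]]|allm] := pselect (exists u a, pi (T u 0)@_a != 0).
- have DT : map_mpoly pi D * map_mpoly pi (T u 0) != 0.
    apply: mulf_neq0; first exact: nonzero.
    by apply/eqP => T0; move: Ta; rewrite -mcoeff_map_mpoly T0 mcoeff0 eqxx.
  have [v] := mpoly_nonroot k_infinite DT; have /choice [l1 l1P] := fun i => pi_surj (v i).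
  rewrite mevalM mulf_eq0 negb_or.
  have <- : (fun i => pi (l1 i)) = v by apply/funext.
  rewrite !meval_map_pi => /andP [Dl1 Tl1].
  (* As [f - y] has entries in [m A], [VT] at [l1] puts a unit multiple of [w] in [V l1 + m A]; by
     [DE] all of [A] then lies there. *)
  pose X := ideal_add (V l1) mA; have iX : is_ideal X by exact: ideal_add_ideal.
  have Xw : X w.
    apply: (local_cancel iX Tl1).
    rewrite mulrC -(addKr (D.@[l1] * (f u 0 - y u 0)) (w * _)) addrC.
    exists (D.@[l1] * (f u 0 - y u 0) + w * (T u 0).@[l1]) => //.
    exists (- (D.@[l1] * (f u 0 - y u 0))) => //; apply: (idealN imA).
    by apply: (idealMl _ imA); apply: (idealB imA) => //; exact: YmA.
  have /choice [x xP] : forall i, exists x, V l1 x /\ mA (e i 0 - x).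
    move=> i; suff [x Vx [z mz <-]] : X (e i 0) by exists x; rewrite addrAC subrr add0r.
    apply: (local_cancel iX Dl1); have /matrixP /(_ i 0) := DE l1; rewrite [in LHS]mxE => ->.
    rewrite mxE [in X in _ + X]mxE; apply: (idealD iX); last exact: (idealMr _ iX).
    apply: (ideal_add_subl imA); apply: mulmx_ideal => // j.
    exact: (mem_colgen _).
  have [|r rE] := @colgen_mulmx _ _ (ev l1 C *m e) (\col_i x i).
    by move=> i; rewrite mxE; have [] := xP i.
  have [|M mM ME] := @ideal_mul_colgen_mulmx _ _ e (\col_i (e i 0 - x i)).
    by move=> i; rewrite mxE; have [] := xP i.
  (* Cramer's rule again, now based at [l1] and with [w = 0]: for general [l] a unit multiple of [e]
     has its entries in [V l]. *)
  have [||E [G [Z [E1 EE]]]] := @cramer_family _ _ e C l1 r 0 0 M => //.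
    rewrite -rE -ME scaler0 addr0; apply/matrixP => i j.
    by rewrite !mxE (ord1 j) addrC subrK.
  exists (map_mpoly pi E).
    apply: (contra_neq (z1 := 1%R : k) (z2 := 0)) (oner_neq0 k) => E0.
    by rewrite -E1 -meval_map_pi E0 meval0.
  move=> l; rewrite meval_map_pi => El.
  have AVl : A `<=` V l.
    apply: colgen_sub => // i; apply: (local_cancel (iV l) El).
    have /matrixP /(_ i 0) := EE l; rewrite [in LHS]mxE scale0r addr0 => ->.
    by apply: mulmx_ideal => // j; exact: (mem_colgen _).
  exists 0; split; first exact: (ideal0 iA).
    by move=> z /AVl Vz; apply: adjoin_sub; apply: (ideal_add_subl iY).
  by move=> z mz; apply: (ideal_add_subl iY); apply: AVl; exact: (ideal_mul_subr iA mz).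
- have Tm u a : m (T u 0)@_a.
    by rewrite mE /=; apply/eqP; apply: contrapT => /negP h; apply: allm; exists u, a.
  (* Only coefficients of [T] are fed to [rho], and these lie in [m]; the value [0] elsewhere is
     arbitrary. *)
  have /choice [rho rhoP] : forall t, exists r : 'rV_p, m t -> t * w = (r *m f) 0 0.
    move=> t; have [mt|nmt] := pselect (m t); last by exists 0.
    have : mA (t * w) by exact: mem_ideal_mul.
    by rewrite fE => /colgenP [r ->]; exists r.
  pose H : 'M[{mpoly R[N]}]_p := \matrix_(u, v)
    \sum_(a <- msupp (T u 0)) rho (T u 0)@_a 0 v *: 'X_[a].
  have HT l : ev l H *m f = w *: ev l T.
    apply/matrixP => u j; rewrite (ord1 j) [RHS]mxE [X in _ = _ * X]mxE mulrC.
    rewrite [in RHS]mevalE mulr_suml mxE.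
    under eq_bigr => v _ do rewrite !mxE rmorph_sum mulr_suml.
    rewrite exchange_big; apply: eq_bigr => a _ /=.
    rewrite mulrAC (rhoP _ (Tm u a)) mxE mulr_suml; apply: eq_bigr => v _.
    by rewrite mevalZ mevalX mulrAC.
  (* [H(l) f = w T(l)], and [T] vanishes at [l0]. Subtracting [H(l0)] therefore keeps
     [F f = D f + w T], while it makes [F(l0)] the scalar matrix of the unit [D(l0)]. *)
  pose F := D%:M + H - cst (ev l0 H).
  have evF l : ev l F = D.@[l]%:M + ev l H - ev l0 H.
    by rewrite map_mxB map_mxD map_scalar_mx ev_cst.
  have F1 : pi (\det F).@[l0] = 1.
    by rewrite -det_map_mx evF addrK det_scalar rmorphXn /= D1 expr1n.
  exists (map_mpoly pi (D * \det F)).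
    by apply: nonzero; rewrite mevalM rmorphM /= D1 F1 mulr1.
  move=> l; rewrite meval_map_pi mevalM rmorphM mulf_eq0 negb_or => /andP [Dl Fl].
  exists w; split=> //.
  + apply: colgen_sub; first exact: (adjoin_ideal w (iVY l)).
    move=> i; apply: (local_cancel (adjoin_ideal w (iVY l)) Dl).
    have /matrixP /(_ i 0) := DE l; rewrite [in LHS]mxE => ->.
    rewrite mxE [in X in _ + X]mxE mulrC; exists ((ev l S) i 0); rewrite mulrC addrK.
    apply: (ideal_add_subl iY); apply: mulmx_ideal => // j.
    exact: (mem_colgen _).
  + rewrite -/A -/mA fE; apply: (colgen_sub (iVY l)) => u; apply: (local_cancel (iVY l) Fl).
    have T0 : ev l0 T = 0 by rewrite evT subrr mulmx0 mul0mx.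
    have /det_scaled_inverse : ev l F *m f = D.@[l] *: f + w *: ev l T.
      by rewrite evF mulmxBl mulmxDl !HT mul_scalar_mx T0 scaler0 subr0.
    rewrite det_map_mx => /matrixP /(_ u 0); rewrite mxE => ->.
    apply: mulmx_ideal => // v; exists (D.@[l] * (f v 0 - y v 0) + w * (T v 0).@[l]) => //.
    exists (D.@[l] * y v 0); first exact: (idealMl _ iY).
    by rewrite !mxE mulrBr addrAC subrK.
Qed.

End Family.
End Perturbation.

(** * Length *)

Section Length.
Context {R : comNzRingType}.
Implicit Types (A B C Q X m : set R) (x y : R).

Lemma length_le_widen A A' B B' n n' : A' `<=` A -> B `<=` B' -> (n <= n')%N ->
  length_le A B n -> length_le A' B' n'.
Proof.
move=> sA sB nn' h l N hN sN; apply: leq_trans nn'; apply: h sN => i il.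
by have [iN BN NA] := hN i il; split=> // x; [move=> /sB /BN|move=> /NA /sA].
Qed.

(** Omitting the repetitions leaves a strict chain with as many steps as there are proper
    inclusions. *)
Lemma length_le_weak_chain A B n l (N : nat -> set R) : length_le A B n ->
  (forall i, (i <= l)%N -> [/\ is_ideal (N i), B `<=` N i & N i `<=` A]) ->
  (forall i, (i < l)%N -> N i `<=` N i.+1) ->
  (\sum_(i < l) `[< ~ N i.+1 `<=` N i >] <= n)%N.
Proof.
move=> AB hN sN; set c := (\sum_(i < l) _)%N.
have [M [MN _ sM]] : exists M : nat -> set R,
    [/\ forall i, (i <= c)%N -> exists2 j, (j <= l)%N & M i = N j, M c = N l
      & forall i, (i < c)%N -> M i `<` M i.+1].
  rewrite {}/c; elim: l hN sN => [|l ih] hN sN.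
    by exists (fun=> N 0%N); rewrite big_ord0; split=> // i _; exists 0%N.
  have [|//|M [MN Mc sM]] := ih; first by move=> i il; apply: hN; exact: leqW.
    by move=> i il; apply: sN; exact: leqW.
  rewrite big_ord_recr /=; set c := (\sum_(i < l) _)%N in MN Mc sM *.
  have [e|ne] := pselect (N l.+1 `<=` N l).
    have -> : `[< ~ N l.+1 `<=` N l >] = false by apply/asboolP => /(_ e).
    exists M; rewrite addn0; split=> //.
    + by move=> i /MN [j jl ->]; exists j => //; exact: leqW.
    + by rewrite Mc; apply/seteqP; split=> //; exact: sN.
  have -> : `[< ~ N l.+1 `<=` N l >] = true by apply/asboolP.
  exists (fun i => if (i <= c)%N then M i else N l.+1); rewrite addn1; split.
  + move=> i _; case: leqP => [/MN [j jl ->]|_]; last by exists l.+1.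
    by exists j => //; exact: leqW.
  + by rewrite ltnn.
  + move=> i; rewrite ltnS => ic; rewrite ic; case: (ltnP i c) => ci; first exact: sM.
    have -> : i = c by lia.
    by rewrite Mc; split=> //; exact: sN.
by apply: AB sM => i /MN [j jl ->]; exact: hN.
Qed.

(** A chain [N] yields its sums with [B] and its intersections with [B]; by the modular law each
    strict step of [N] stays strict in at least one of the two. *)
Lemma length_le_trans A B C a b : is_ideal A -> is_ideal B -> C `<=` B -> B `<=` A ->
  length_le A B a -> length_le B C b -> length_le A C (a + b).
Proof.
move=> iA iB CB BA hAB hBC l N hN sN.
have iN i : (i <= l)%N -> is_ideal (N i) by move=> /hN [].
have hs : (\sum_(i < l) `[< ~ ideal_add (N i.+1) B `<=` ideal_add (N i) B >] <= a)%N.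
  apply: (length_le_weak_chain (N := fun i => ideal_add (N i) B) hAB) => i il.
    have [iNi CN NA] := hN i il; split; [exact: ideal_add_ideal|exact: (ideal_add_subr iNi)|].
    exact: (ideal_add_min iA).
  apply: (ideal_add_min (ideal_add_ideal (iN _ il) iB)); last first.
    exact: (ideal_add_subr (iN _ il)).
  by move=> x Nx; apply: (ideal_add_subl iB); apply: (properW (sN _ il)).
have ht : (\sum_(i < l) `[< ~ N i.+1 `&` B `<=` N i `&` B >] <= b)%N.
  apply: (length_le_weak_chain (N := fun i => N i `&` B) hBC) => i il.
    have [iNi CN NA] := hN i il; split=> [|x Cx|x []//]; last by split; [exact: CN|exact: CB].
    split=> [|x y [? ?] [? ?]|x y [? ?]].
    - by split; exact: ideal0.
    - by split; [exact: (idealD iNi)|exact: (idealD iB)].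
    - by split; [exact: (idealMl _ iNi)|exact: (idealMl _ iB)].
  by move=> x [Nx Bx]; split=> //; apply: (properW (sN _ il)).
apply: leq_trans (leq_add hs ht); rewrite -big_split /= -[X in (X <= _)%N]card_ord -sum1_card.
apply: leq_sum => i _; have [//|/asboolPn/contrapT sP] := boolP `[< ~ ideal_add _ _ `<=` _ >].
have [//|/asboolPn/contrapT sI] := boolP `[< _ >]; exfalso.
have [_] := sN i (ltn_ord i); apply=> x Nx.
have [y Ny [z Bz xE]] := sP x (ideal_add_subl iB Nx).
rewrite -xE; apply: (idealD (iN i (ltnW (ltn_ord i)))) => //.
have zE : z = x - y by rewrite -xE addrC addKr.
have [] // : (N i `&` B) z; apply: sI; split=> //; rewrite zE.
by apply: (idealB (iN _ (ltn_ord i))) => //; apply: (properW (sN _ (ltn_ord i))).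
Qed.

(** [(B + (x)) / B] is cyclic and killed by [Q], hence a quotient of [R / Q]; chains are pulled back
    along multiplication by [x]. *)
Lemma length_le_adjoin B Q x c : is_ideal B -> is_ideal Q ->
  (forall q, Q q -> B (q * x)) -> length_le setT Q c -> length_le (adjoin B x) B c.
Proof.
move=> iB iQ Qx hQ l N hN sN; apply: (hQ l (fun i => [set r | N i (r * x)])) => i il.
  have [iN BN _] := hN i il; split=> //; last by move=> q /Qx /BN.
  split=> [|u v /= ? ?|u v /= ?].
  - by rewrite /= mul0r; exact: ideal0.
  - by rewrite mulrDl; exact: (idealD iN).
  - by rewrite -mulrA; exact: (idealMl _ iN).
have [NN nN] := sN i il; split=> [r /=|h]; first exact: NN.
have [iN BN NB] := hN i.+1 il; have [iN' BN' _] := hN i (ltnW il).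
apply: nN => y Ny; have [r Byr] := NB y Ny.
rewrite -(subrK (r * x) y); apply: (idealD iN'); first exact: BN'.
by apply: h; rewrite /= -(subKr y (r * x)); apply: (idealB iN) => //; exact: BN.
Qed.

Lemma length_le_maximal m : maximal_ideal m -> length_le setT m 1.
Proof.
move=> [im m1 mmax] l N hN sN; rewrite leqNgt; apply/negP => l2.
have [iN1 mN1 _] := hN 1%N (ltnW l2); have [iN0 mN0 _] := hN 0%N isT.
have [N11|N11] := pselect (N 1%N 1).
  by have [_] := sN 1%N l2; rewrite (ideal_full iN1 N11); apply.
have [_] := sN 0%N (ltnW l2); apply; rewrite (mmax _ iN1 N11 mN1); exact: mN0.
Qed.

Lemma length_le_id A n : length_le A A n.
Proof.
move=> [//|l] N hN sN; have [_ []] := sN 0%N isT => x Nx.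
by have [_ + _] := hN 0%N isT; apply; have [_ _] := hN 1%N isT; apply.
Qed.

(** Noetherian induction: passing from [A] to [A + (x)] costs length at most one when [m x] lies in
    [A]. *)
Lemma finite_length m s A : noetherian R -> maximal_ideal m -> is_ideal A ->
  ideal_pow m s `<=` A -> exists c, length_le setT A c.
Proof.
move=> noeth mmax; have [im m1 _] := mmax.
apply: (noetherian_ind (G := fun A => ideal_pow m s `<=` A ->
  exists c, length_le setT A c) noeth) => {}A iA ih msA.
have [A1|nA1] := pselect (A 1).
  by exists 0%N; rewrite (ideal_full iA A1); exact: length_le_id.
(* Such an [x] is any element of [m^n] outside [A], where [n + 1] is the least exponent with
   [m^(n+1)] inside [A]. *)
have [x nAx mx] : exists2 x, ~ A x & forall q, m q -> A (q * x).
  have : exists n, `[< ideal_pow m n `<=` A >] by exists s; apply/asboolP.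
  move=> /ex_minnP [[|n] /asboolP mA min_n]; first by case: nA1; exact: mA.
  have /existsNP [x /not_implyP [mx nAx]] : ~ (ideal_pow m n `<=` A).
    by move=> h; have := min_n n; rewrite ltnn => /(_ (introT (asboolP _) h)).
  by exists x => // q mq; apply: mA; rewrite mulrC; exact: mem_ideal_mul.
have [] := ih (adjoin A x); [exact: adjoin_ideal|exact: adjoin_proper| |move=> c hc].
  by move=> y /msA; exact: adjoin_sub.
exists (c + 1)%N; apply: length_le_trans hc _ => //; [exact: adjoin_ideal|exact: adjoin_sub|].
by apply: (length_le_adjoin iA im mx); exact: length_le_maximal.
Qed.

Lemma adjoinC A x y : adjoin (adjoin A x) y = adjoin (adjoin A y) x.
Proof.
by apply/seteqP; split=> z [r [s Az]]; exists s; exists r; rewrite addrAC.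
Qed.

(** In the filtration by the ideals [B + (x^i)], each successive quotient is cyclic and killed by
    [B + (x)]. *)
Lemma length_le_adjoin_pow B x c n : is_ideal B -> length_le setT (adjoin B x) c ->
  length_le setT (adjoin B (x ^+ n)) (n * c).
Proof.
move=> iB hc; elim: n => [|n ih].
  rewrite expr0 (@ideal_full _ (adjoin B 1)); first exact: length_le_id.
    exact: adjoin_ideal.
  exact: mem_adjoin.
rewrite mulSn addnC; have iB' := adjoin_ideal (x ^+ n.+1) iB.
apply: length_le_trans ih _ => //; first exact: adjoin_ideal.
  apply: (adjoin_min (adjoin_ideal _ iB)); first exact: adjoin_sub.
  by rewrite exprS; apply: (idealMl _ (adjoin_ideal _ iB)); exact: mem_adjoin.
apply: (@length_le_widen (adjoin (adjoin B (x ^+ n.+1)) (x ^+ n)) _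
  (adjoin B (x ^+ n.+1)) _ c) => //.
  by apply: adjoinS; exact: adjoin_sub.
apply: (length_le_adjoin iB' (adjoin_ideal x iB) _ hc) => q [r Bq].
exists r; rewrite exprS mulrA -mulrBl; exact: (idealMr _ iB).
Qed.

(** The generators are replaced by their [n]-th powers one at a time, each replacement multiplying
    the bound by [n]. *)
Lemma length_le_gen_pow (xs : seq R) X c n : length_le setT (ideal_gen [set` xs]) c ->
  is_ideal X -> (forall x, x \in xs -> X (x ^+ n)) ->
  length_le setT X (n ^ size xs * c).
Proof.
move=> hc iX Xn; pose ext (B : set R) := foldr (fun x A => adjoin A x) B.
have ext_ideal B ys : is_ideal B -> is_ideal (ext B ys).
  by move=> iB; elim: ys => //= y ys; exact: adjoin_ideal.
have extC B ys x : ext (adjoin B x) ys = adjoin (ext B ys) x.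
  by elim: ys => //= y ys ->; rewrite adjoinC.
have i0 : is_ideal [set 0 : R].
  by split=> [|x y -> ->|x y ->] //=; rewrite ?addr0 ?mulr0.
have h0 : length_le setT (ext [set 0] xs) c.
  apply: length_le_widen hc => //; apply: ideal_gen_min; first exact: ext_ideal.
  move=> y /=; elim: xs {Xn} => //= x xs ih; rewrite inE => /predU1P [->|/ih].
    by apply: mem_adjoin; exact: ext_ideal.
  exact: adjoin_sub.
apply: (@length_le_widen setT _ (ext [set 0] [seq x ^+ n | x <- xs]) _ (n ^ size xs * c)) => //.
  elim: xs Xn {hc h0} => [|x xs ih] Xn /=; first by move=> _ ->; exact: ideal0.
  apply: adjoin_min => //; last by apply: Xn; rewrite inE eqxx.
  by apply: ih => y yxs; apply: Xn; rewrite inE yxs orbT.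
move: i0 c h0 {hc Xn}; move: [set 0 : R] => B.
elim: xs B => [|x xs ih] B iB c hc /=; first by rewrite mul1n.
rewrite -extC expnSr -mulnA; apply: ih; first exact: adjoin_ideal.
by rewrite extC; apply: length_le_adjoin_pow => //; exact: ext_ideal.
Qed.

End Length.

(** * Cohen-Macaulay local rings *)

Section LocalRing.
Context {R : comNzRingType}.
Implicit Types (A P m : set R) (x y : R).

Lemma maximal_above A : noetherian R -> is_ideal A -> ~ A 1 ->
  exists2 M, maximal_ideal M & A `<=` M.
Proof.
move=> noeth; move: A; apply: (noetherian_ind (G := fun A => ~ A 1 ->
  exists2 M, maximal_ideal M & A `<=` M) noeth) => A iA ih A1.
have [mA|nmA] := pselect (maximal_ideal A); first by exists A.
have [B [iB B1 AB BA]] : exists B, [/\ is_ideal B, ~ B 1, A `<=` B & B <> A].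
  apply: contrapT => h; apply: nmA; split=> // B iB B1 AB.
  by apply: contrapT => BA; apply: h; exists B.
have [||M mM BM] := ih B iB; first by split=> // BA'; apply: BA; apply/seteqP.
  exact: B1.
by exists M => //; exact: subset_trans BM.
Qed.

Lemma local_sub m A : noetherian R -> is_local m -> is_ideal A -> ~ A 1 -> A `<=` m.
Proof. by move=> noeth [_ mu] iA /(maximal_above noeth iA) [M /mu ->]. Qed.

Lemma local_unit m x : noetherian R -> is_local m -> ~ m x -> exists y, y * x = 1.
Proof.
move=> noeth lm nmx; apply: contrapT => nx; apply: nmx.
apply: (@local_sub m [set y | exists r, y = r * x]) => //; last by exists 1; rewrite mul1r.
  split=> [|u v [r ->] [s ->]|u v [r ->]].
  - by exists 0; rewrite mul0r.
  - by exists (r + s); rewrite mulrDl.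
  - by exists (u * r); rewrite mulrA.
by move=> [r e]; apply: nx; exists r.
Qed.

(** Induction on [i]. If every prime between the ideal of the first [i] terms and [P] contained the
    next term [x], then [x^n u] would lie in that ideal for some [u] outside [P], and regularity
    would put [u] in it. So some prime below [P] omits [x]. *)
Lemma regular_sequence_height (xs : seq R) i P : noetherian R -> regular_sequence xs ->
  (i <= size xs)%N -> prime_ideal P -> ideal_gen [set` take i xs] `<=` P ->
  exists2 Ps, prime_chain i Ps & Ps i = P.
Proof.
move=> noeth [_ reg]; elim: i P => [|i ih] P ixs pP AP.
  by exists (fun=> P) => //; split.
set A := ideal_gen [set` take i xs].
have iA : is_ideal A by exact: ideal_gen_is_ideal.
have takeS : take i.+1 xs = rcons (take i xs) xs`_i by rewrite -take_nth.
have Px : P xs`_i.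
  by apply: AP; apply: mem_ideal_gen; rewrite /= takeS mem_rcons inE eqxx.
have AP' : A `<=` P.
  apply: ideal_gen_min; first by case: pP.
  by move=> x xA; apply: AP; apply: mem_ideal_gen; rewrite /= takeS mem_rcons inE xA orbT.
have [Q [pQ AQ QP Qx]] : exists Q, [/\ prime_ideal Q, A `<=` Q, Q `<=` P & ~ Q xs`_i].
  apply: contrapT => h; have [|u [n [nPu]]] := @primes_mem_pow _ A P xs`_i noeth iA pP.
    by move=> Q pQ AQ QP; apply: contrapT => nQx; apply: h; exists Q.
  move=> Axu; apply: nPu; apply: AP'; elim: n Axu => [|n ihn]; first by rewrite mul1r.
  by rewrite exprSr mulrAC => /(reg i ixs).
have [Ps [Pp sP] PsQ] := ih Q (ltnW ixs) pQ AQ.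
exists (fun j => if (j <= i)%N then Ps j else P); last by rewrite ltnn.
split=> j; first by case: (leqP j i) => // /Pp.
rewrite ltnS => ji; rewrite ji; case: (ltnP j i) => [|ij]; first exact: sP.
have -> : j = i by lia.
by rewrite PsQ; split=> // /(_ _ Px).
Qed.

(** A prime over the sequence other than [m] would end a chain of length [size xs], which [m] would
    prolong beyond the dimension. *)
Lemma regular_sequence_primary (xs : seq R) m : noetherian R -> is_local m ->
  regular_sequence xs -> krull_dim R (size xs) ->
  exists n, ideal_pow m n `<=` ideal_gen [set` xs].
Proof.
move=> noeth lm reg [_ dimR]; have iX := ideal_gen_is_ideal [set` xs].
apply: (primes_eq_pow_sub noeth iX) => P pP XP; have [iP P1 _] := pP.
have Pm : P `<=` m by exact: local_sub.
apply: contrapT => nPm.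
have [|Ps [Pp sP] PsP] := regular_sequence_height noeth reg (leqnn _) pP.
  by rewrite take_size.
have pm : prime_ideal m.
  have [mm _] := lm; have [im m1 mmax] := mm; split=> // x y mxy.
  have [|nx] := pselect (m x); [by left|right].
  have [z zx] := local_unit noeth lm nx.
  by rewrite -(mul1r y) -zx -mulrA; exact: (idealMl _ im).
suff : (size xs < size xs)%N by rewrite ltnn.
apply: (dimR (size xs).+1 (fun j => if (j <= size xs)%N then Ps j else m)).
split=> j; first by case: (leqP j (size xs)) => // /Pp.
rewrite ltnS => ji; rewrite ji; case: (ltnP j (size xs)) => [|ij]; first exact: sP.
have -> : j = size xs by lia.
by rewrite PsP; split=> // mP; apply: nPm; apply/seteqP.
Qed.

(** If [H] contains the [N]-th powers of the terms of a regular sequence of length [d], then [H^n]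
    contains their [N n]-th powers, which generate an ideal of colength at most a constant times
    [(N n)^d]. *)
Lemma hilbert_samuel_bound m d (H : set R) : cohen_macaulay_local m -> krull_dim R d ->
  is_ideal H -> m `<=` radical H ->
  exists c, forall n, length_le setT (ideal_pow H n) (c * n ^ d).
Proof.
move=> [noeth lm [d' dim' [[xs [sxs xm reg]] _]]] dimR iH mH.
have dd : size xs = d.
  rewrite sxs; have [[P hP] maxd'] := dim'; have [[Q hQ] maxd] := dimR.
  by apply/eqP; rewrite eqn_leq (maxd _ _ hP) (maxd' _ _ hQ).
have [|s ms] := regular_sequence_primary noeth lm reg; first by rewrite dd.
have [c hc] := finite_length noeth (proj1 lm) (ideal_gen_is_ideal _) ms.
have [N HN] : exists N, forall x, x \in xs -> H (x ^+ N).
  have : {in xs, forall x, m x} by move=> x /xm.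
  elim: xs {sxs xm reg dd s ms c hc} => [|x xs ih] hm; first by exists 0%N.
  have [N HN] := ih (fun y yxs => hm y (mem_behead (s := x :: xs) yxs)).
  have [M HM] := mH _ (hm x (mem_head _ _)).
  exists (N + M)%N => y; rewrite inE exprD => /predU1P [->|/HN].
    exact: (idealMl _ iH).
  exact: (idealMr _ iH).
exists (N ^ d * c)%N => n; have -> : (N ^ d * c * n ^ d = (N * n) ^ size xs * c)%N.
  by rewrite dd expnMn; lia.
apply: (length_le_gen_pow hc) => [|x xxs]; first exact: ideal_pow_ideal.
by rewrite exprM; apply: mem_ideal_pow; exact: HN.
Qed.

End LocalRing.

(** * Homogeneous relations between the elements of a generating family *)

Section Relation.
Context {R : comNzRingType}.
Variables (H : set R) (r : nat) (y : 'I_r -> R).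
Hypotheses (iH : is_ideal H) (Hy : forall i, H (y i)).

Lemma mem_pow_meval (p : {mpoly R[r]}) e :
  (forall a, a \in msupp p -> (e <= mdeg a)%N) -> ideal_pow H e p.@[y].
Proof.
move=> he; rewrite mevalE big_seq; apply: ideal_sum => [|a /he ea].
  exact: ideal_pow_ideal.
apply: (idealMl _ (ideal_pow_ideal H e)); apply: (ideal_pow_le ea).
rewrite mdegE; apply: (big_ind2 (fun u n => ideal_pow H n u)) => //.
  by move=> u n v n' hu hv; rewrite ideal_powD; exact: mem_ideal_mul.
by move=> i _; exact: mem_ideal_pow.
Qed.

Let extend (B : set R) (s : seq 'X_{1..r}) :=
  foldl (fun A a => adjoin A (meval y 'X_[a])) B s.

Let extend_ideal B s : is_ideal B -> is_ideal (extend B s).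
Proof. by elim: s B => //= a s ih B iB; apply: ih; exact: adjoin_ideal. Qed.

Let extend_sub B s : B `<=` extend B s.
Proof.
by elim: s B => [|a s ih] B //=; apply: subset_trans (ih _); exact: adjoin_sub.
Qed.

Let mem_extend B s x : extend B s x ->
  exists2 p : {mpoly R[r]}, (forall a, a \notin s -> p@_a = 0) & B (x - p.@[y]).
Proof.
elim/last_ind: s x => [|s a ih] x.
  by exists 0 => [a _|]; rewrite ?mcoeff0 // meval0 subr0.
rewrite /extend -cats1 foldl_cat /= => -[c /ih [p ps Bp]].
exists (p + c *: 'X_[a]) => [b|]; last by rewrite mevalD mevalZ opprD addrA addrAC.
rewrite mem_cat negb_or inE => /andP [/ps pb ba].
by rewrite mcoeffD pb mcoeffZ mcoeffX eq_sym (negPf ba) mulr0 addr0.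
Qed.

Lemma mcoeff_pihomog (p : {mpoly R[r]}) e a :
  (pihomog mdeg e p)@_a = if mdeg a == e then p@_a else 0.
Proof.
rewrite pihomogE raddf_sum /= big_mkcond /=.
have [ap|/memN_msupp_eq0 pa] := boolP (a \in msupp p); last first.
  rewrite pa if_same big1_seq // => b _; case: ifP => // _.
  rewrite mcoeffZ mcoeffX; case: eqP => [->|_]; last by rewrite mulr0.
  by rewrite pa mul0r.
rewrite (bigD1_seq a) ?msupp_uniq //= mcoeffZ mcoeffX eqxx mulr1.
rewrite big1 ?addr0 // => b /negPf ba.
by case: ifP => // _; rewrite mcoeffZ mcoeffX ba mulr0.
Qed.

(* There are [t ^ r] monomials with exponents below [t]; sorted by decreasing degree,
   they generate a chain of ideals above [H ^ (r t)] too long to be strict. *)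
Lemma homogeneous_relation c d : (d < r)%N ->
  (forall n, length_le setT (ideal_pow H n) (c * n ^ d)) ->
  (* This [t] makes [c (r t)^d] smaller than [t^r], since [c r^d < t] and [d < r]. *)
  exists e (p : {mpoly R[r]}), [/\ forall a, a \in msupp p -> mdeg a = e,
    exists a, p@_a = 1 & ideal_pow H e.+1 p.@[y]].
Proof.
move=> dr hc; pose t := (c * r ^ d).+1.
pose B := ideal_pow H (r * t); have iB : is_ideal B by exact: ideal_pow_ideal.
pose mon (f : {ffun 'I_r -> 'I_t}) : 'X_{1..r} := [multinom (f i : nat) | i < r].
have mon_inj : injective mon.
  move=> f g /mnmP fg; apply/ffunP => i; apply/val_inj.
  by have := fg i; rewrite !mnmE.
pose geq_deg := [rel a b : 'X_{1..r} | (mdeg b <= mdeg a)%N].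
pose s := sort geq_deg [seq mon f | f <- enum {ffun 'I_r -> 'I_t}].
have size_s : size s = (t ^ r)%N.
  by rewrite size_sort size_map -cardE card_ffun !card_ord.
have uniq_s : uniq s by rewrite sort_uniq map_inj_uniq // enum_uniq.
have geq_trans : transitive geq_deg by move=> b a e /= ba be; exact: leq_trans be ba.
have sorted_s : sorted geq_deg s.
  by apply: sort_sorted => a b /=; exact: leq_total.
have deg_s a : a \in s -> (mdeg a < r * t)%N.
  rewrite mem_sort => /mapP [f _ ->]; rewrite mdegE.
  apply: (@leq_ltn_trans (\sum_(i < r) t.-1)).
    by apply: leq_sum => i _; rewrite mnmE; have := ltn_ord (f i); rewrite ltnS.
  by rewrite sum_nat_const card_ord /=; nia.
pose N i := extend B (take i s).
have iN i : is_ideal (N i) by exact: extend_ideal.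
have NS i : (i < size s)%N -> N i.+1 = adjoin (N i) (meval y 'X_[nth 0%MM s i]).
  by move=> il; rewrite /N (take_nth 0%MM) // /extend -cats1 foldl_cat.
have [i [il Ni]] : exists i, (i < size s)%N /\ N i (meval y 'X_[nth 0%MM s i]).
  apply: contrapT => h.
  have : (size s <= c * (r * t) ^ d)%N.
    apply: (hc (r * t)%N (size s) N) => i il; last first.
      rewrite NS //; apply: adjoin_proper => // Ni.
      by apply: h; exists i.
    by split=> //; exact: extend_sub.
  rewrite size_s leqNgt => /negP; apply.
  apply: (@leq_trans (t * t ^ d)%N); last by rewrite -expnS leq_pexp2l.
  by rewrite expnMn mulnA ltn_mul2r expn_gt0 /= /t ltnS leqnn.
have [q qs Bq] := mem_extend Ni; set a := nth 0%MM s i in Ni Bq.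
have aNs : a \notin take i s by rewrite in_take ?mem_nth // index_uniq // ltnn.
have deg_take b : b \in take i s -> (mdeg a <= mdeg b)%N.
  move=> bi; have bs := mem_take bi; move: bi; rewrite in_take // => bi.
  have := sorted_ltn_nth geq_trans 0%MM sorted_s (index b s) i.
  by rewrite !inE index_mem bs il bi nth_index // => /(_ isT isT isT).
(* No term of [p] has degree below [e], and [p(y)] lies in [H^(r t)], hence in [H^(e+1)]. The terms
   of degree above [e] take values in [H^(e+1)] too, so the component of degree [e] does as well. *)
pose p := 'X_[a] - q; pose e := mdeg a.
have pa : p@_a = 1 by rewrite mcoeffB mcoeffX eqxx qs // subr0.
have deg_p b : b \in msupp p -> (e <= mdeg b)%N.
  rewrite mcoeff_msupp mcoeffB mcoeffX; have [<-//|ab] := eqVneq a b.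
  have [/deg_take//|/qs ->] := boolP (b \in take i s).
  by rewrite subr0 eqxx.
exists e, (pihomog mdeg e p); split.
- by move=> b; rewrite mcoeff_msupp mcoeff_pihomog; case: (mdeg b =P e) => //; rewrite eqxx.
- by exists a; rewrite mcoeff_pihomog eqxx.
rewrite -(subKr p (pihomog _ _ _)) mevalB; apply: (idealB (ideal_pow_ideal H e.+1)).
  rewrite mevalB; apply: (ideal_pow_le (j := r * t)); last exact: Bq.
  by apply: deg_s; exact: mem_nth.
apply: mem_pow_meval => b; rewrite mcoeff_msupp mcoeffB mcoeff_pihomog.
case: (mdeg b =P e) => [_|be]; first by rewrite subrr eqxx.
rewrite subr0 -mcoeff_msupp => /deg_p; rewrite leq_eqVlt => /predU1P [eb|//].
by case: be.
Qed.

End Relation.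

(** * Minimal reductions *)

Section Reduction.
Context {R : comNzRingType} {k : fieldType} (pi : {rmorphism R -> k}).
Variable m : set R.
Hypotheses (R_noeth : noetherian R) (k_infinite : infinite_set [set: k]).
Hypotheses (m_ideal : is_ideal m) (mE : m = [set x | pi x = 0]).
Hypothesis pi_surj : forall c : k, exists x, pi x = c.
Hypothesis pi_unit : forall x, pi x != 0 -> exists y, y * x = 1.
Implicit Types (H I J : set R).

(** [I^(q+n) = H^q I^n] for all [q], so [H^(p+1) = J H^p] gives [I^(p+1+n) = J I^(p+n)]. *)
Lemma reduction_trans H I J : reduction J H -> reduction H I -> reduction J I.
Proof.
move=> [iJ JH [p Hp]] [iH HI [n In]]; split=> //; first exact: subset_trans HI.
have pow q : ideal_pow I (q + n) = ideal_mul (ideal_pow H q) (ideal_pow I n).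
  elim: q => [|q ih]; first by rewrite ideal_mulC ideal_mulT //; exact: ideal_pow_ideal.
  have -> : (q.+1 + n = q + n + 1)%N by lia.
  rewrite ideal_powD ih -ideal_mulA -ideal_powD addn1 In ideal_mulA.
  by congr ideal_mul.
exists (p + n)%N; rewrite -addSn pow Hp -ideal_mulA; congr ideal_mul.
by rewrite pow.
Qed.

Lemma nakayama_mul H X : is_ideal H -> is_ideal X ->
  H `<=` ideal_add X (ideal_mul m H) -> H `<=` X.
Proof.
move=> iH iX; have [n [a Ha]] := R_noeth iH.
have -> : H = colgen (\col_i a i).
  rewrite Ha /colgen; suff <- : a = (fun i => (\col_i a i) i 0) by [].
  by apply/funext => i; rewrite mxE.
exact: (nakayama m_ideal mE pi_unit iX).
Qed.

(** * Elimination of one generator by a linear change *)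

Section Descent.
Context {r : nat}.
Variables (H : set R) (y : 'I_r.+1 -> R) (v : 'I_r.+1 -> R) (i0 : 'I_r.+1).
Hypotheses (HE : H = ideal_gen (range y)) (Hm : H `<=` m) (vi0 : pi (v i0) != 0).

(** Values at [y] of linear forms vanishing at the point [v]. As [z i0 = 0], the other [r] of them
    generate [J]. *)
Let z j := v i0 * y j - v j * y i0.
Let J := ideal_gen (range (fun j : 'I_r => z (lift i0 j))).

Let iH : is_ideal H. Proof. by rewrite HE; exact: ideal_gen_is_ideal. Qed.
Let iJ : is_ideal J. Proof. exact: ideal_gen_is_ideal. Qed.
Let Hy j : H (y j). Proof. by rewrite HE; exact: (mem_range_gen (a := y)). Qed.

Let Jz j : J (z j).
Proof.
have [l ->|->] := unliftP i0 j; first by apply: mem_ideal_gen; exists l.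
by rewrite /z subrr; exact: ideal0.
Qed.

Let JH : J `<=` H.
Proof.
apply: (ideal_gen_min iH) => _ [j _ <-].
by apply: (idealB iH); exact: (idealMl _ iH).
Qed.

(** For [e >= 1] this is the degree [e] part of the ideal generated by [J], placed in degree one, in
    the Rees algebra of [H]; for [e = 0] truncated subtraction gives [J]. *)
Let T e := ideal_mul J (ideal_pow H e.-1).
Let iT e : is_ideal (T e). Proof. exact: ideal_mul_ideal. Qed.

Let T_mul e e' a b : T e a -> ideal_pow H e' b -> T (e + e')%N (a * b).
Proof.
move=> Ta Hb; suff : ideal_mul (T e) (ideal_pow H e') (a * b).
  rewrite /T -ideal_mulA -ideal_powD; apply: ideal_mulS => //.
  by apply: ideal_pow_le; lia.
exact: mem_ideal_mul.
Qed.

(** Congruence modulo [T e] inside [H^e]; membership in [H^e] lets [T] absorb the cross terms of a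
    product. *)
Let close e (a b : R) : Prop := [/\ ideal_pow H e a, ideal_pow H e b & T e (a - b)].

Let closeM e e' a b a' b' : close e a b -> close e' a' b' -> close (e + e')%N (a * a') (b * b').
Proof.
move=> [Ha Hb Tab] [Ha' Hb' Tab']; split.
- by rewrite ideal_powD; exact: mem_ideal_mul.
- by rewrite ideal_powD; exact: mem_ideal_mul.
have -> : a * a' - b * b' = (a - b) * a' + (a' - b') * b by ring.
apply: (idealD (iT _)); first exact: T_mul.
by rewrite addnC; exact: T_mul.
Qed.

Let close0 : close 0 1 1.
Proof. by split=> //; rewrite subrr; exact: ideal0. Qed.

Let close1 j : close 1 (v i0 * y j) (v j * y i0).
Proof.
split; last by rewrite /T ideal_mulT //; exact: Jz.
- by rewrite ideal_pow1 //; exact: (idealMl _ iH).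
- by rewrite ideal_pow1 //; exact: (idealMl _ iH).
Qed.

Let closeX e j : close e ((v i0 * y j) ^+ e) ((v j * y i0) ^+ e).
Proof.
elim: e => [|e ih]; first by rewrite !expr0.
by rewrite !exprSr -addn1; exact: closeM.
Qed.

Let close_monomial (a : 'X_{1..r.+1}) :
  T (mdeg a) (v i0 ^+ mdeg a * ('X_[a] : {mpoly R[r.+1]}).@[y]
              - ('X_[a] : {mpoly R[r.+1]}).@[v] * y i0 ^+ mdeg a).
Proof.
suff [_ _] : close (mdeg a) (v i0 ^+ mdeg a * ('X_[a] : {mpoly R[r.+1]}).@[y])
  (('X_[a] : {mpoly R[r.+1]}).@[v] * y i0 ^+ mdeg a) by [].
rewrite !mevalX !mdegE -!prodrXr -!big_split /=.
apply: (big_rec3 (fun e a b => close e a b)) => // j e b c _ bc.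
by rewrite -!exprMn; apply: closeM.
Qed.

Let H_adjoin : H `<=` adjoin J (y i0).
Proof.
have iA := adjoin_ideal (y i0) iJ; rewrite HE.
apply: (ideal_gen_min iA) => _ [j _ <-]; apply: (local_cancel pi_unit iA vi0).
by exists (v j); exact: Jz.
Qed.

Let pow_adjoin e : ideal_pow H e `<=` adjoin (T e) (y i0 ^+ e).
Proof.
elim: e => [|e ih] /=.
  by rewrite expr0 (ideal_full (adjoin_ideal 1 (iT 0))) //; exact: mem_adjoin.
have iA := adjoin_ideal (y i0 ^+ e.+1) (iT e.+1).
apply: (ideal_mul_min iA) => a b Ha Hb.
have [c Tc] := ih _ Ha; have [c' Jc'] := H_adjoin Hb.
exists (c * c').
have -> : a * b - c * c' * y i0 ^+ e.+1 =
    (a - c * y i0 ^+ e) * b + (b - c' * y i0) * (c * y i0 ^+ e) by rewrite exprS; ring.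
apply: (idealD (iT e.+1)).
  by rewrite -addn1; apply: T_mul => //; rewrite ideal_pow1.
apply: mem_ideal_mul => //; apply: (idealMl _ (ideal_pow_ideal H e)).
exact: mem_ideal_pow.
Qed.

(* Modulo [J H^(e-1)] each [v i0 * y j] may be replaced by [v j * y i0], which turns
   the relation [p(y) = 0] into [p(v) (y i0)^e = 0] with [p(v)] a unit. *)
Lemma descent_reduction e (p : {mpoly R[r.+1]}) :
  (forall a, a \in msupp p -> mdeg a = e.+1) -> pi p.@[v] != 0 ->
  ideal_pow H e.+2 p.@[y] -> reduction J H.
Proof.
move=> hp pv py; split=> //; exists e.
have Tp : T e.+1 (v i0 ^+ e.+1 * p.@[y] - p.@[v] * y i0 ^+ e.+1).
  rewrite [in X in _ - X](mpolyE p) [in X in X - _](mpolyE p) !rmorph_sum /=.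
  rewrite mulr_sumr mulr_suml -sumrB big_seq; apply: ideal_sum => // a /hp ea.
  rewrite !mevalZ mulrCA -mulrA -mulrBr; apply: (idealMl _ (iT _)).
  by rewrite -ea; exact: close_monomial.
apply/seteqP; split; last first.
  by rewrite [X in _ `<=` X]/= ideal_mulC; apply: ideal_mulS.
(* By Nakayama it is enough to work modulo [m H^(e+1)], which contains [H^(e+2)] and hence
   [p(y)]. *)
apply: (nakayama_mul (ideal_pow_ideal H e.+1) (ideal_mul_ideal _ _)).
set X := ideal_add _ _.
have iX : is_ideal X by apply: ideal_add_ideal; exact: ideal_mul_ideal.
have TX : T e.+1 `<=` X by apply: ideal_add_subl; exact: ideal_mul_ideal.
have HX : ideal_pow H e.+2 `<=` X.
  move=> x Hx; apply: (ideal_add_subr (ideal_mul_ideal _ _)).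
  move: Hx; rewrite [ideal_pow H e.+2]/= ideal_mulC; exact: ideal_mulS.
move=> x /pow_adjoin; apply: (adjoin_min iX TX).
apply: (local_cancel pi_unit iX pv).
rewrite -(subKr (v i0 ^+ e.+1 * p.@[y]) (_ * _)); apply: (idealB iX); last exact: TX.
by apply: (idealMl _ iX); exact: HX.
Qed.

End Descent.

Lemma reduction_fewer_generators (H : set R) r (y : 'I_r.+1 -> R) e (p : {mpoly R[r.+1]}) :
  H = ideal_gen (range y) -> H `<=` m ->
  (forall a, a \in msupp p -> mdeg a = e) -> (exists a, p@_a = 1) ->
  ideal_pow H e.+1 p.@[y] ->
  exists y' : 'I_r -> R, reduction (ideal_gen (range y')) H.
Proof.
move=> HE Hm hp [a pa] py; have iH : is_ideal H by rewrite HE; exact: ideal_gen_is_ideal.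
have p0 : map_mpoly pi p != 0.
  apply/eqP => p0; have := mcoeff_map_mpoly pi a p.
  by rewrite p0 mcoeff0 pa /= rmorph1 => /eqP; rewrite eq_sym oner_eq0.
have [w] := mpoly_nonroot k_infinite p0; have /choice [v vP] := fun i => pi_surj (w i).
have <- : (fun i => pi (v i)) = w by apply/funext.
rewrite meval_map_pi => pv.
(* In degree [0] the relation would put the unit [p(v)] in [H], inside [m]. *)
case: e hp py => [|e] hp py.
  have pyv : p.@[y] = p.@[v].
    rewrite !mevalE big_seq [RHS]big_seq; apply: eq_bigr => b /hp /eqP.
    by rewrite mdeg_eq0 => /eqP ->; congr (_ * _); apply: eq_bigr => i _; rewrite mnm0E.
  by move: py; rewrite ideal_pow1 // pyv => /Hm; rewrite mE /= => pv0; rewrite pv0 eqxx in pv.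
(* A form of positive degree vanishes at the origin, so [v] is nonzero modulo [m]. *)
have [i vi] : exists i, pi (v i) != 0.
  apply: contrapT => h; move/eqP: pv; apply.
  rewrite mevalE rmorph_sum big_seq big1 // => b /hp be.
  have [i bi] : exists i, (0 < b i)%N.
    apply: contrapT => hb; move: be; rewrite mdegE big1 // => i _.
    by apply/eqP; rewrite -leqn0 leqNgt; apply/negP => bi; apply: hb; exists i.
  rewrite rmorphM rmorph_prod (bigD1 i) //= rmorphXn /=.
  have -> : pi (v i) = 0 by apply/eqP; apply: contrapT => /negP vi; apply: h; exists i.
  by rewrite expr0n eqn0Ngt bi mul0r mulr0.
by eexists; exact: (descent_reduction HE Hm vi hp pv py).
Qed.

Lemma minimal_reduction_generators d (H I : set R) : cohen_macaulay_local m -> krull_dim R d ->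
  minimal_reduction H I -> I `<=` m -> m `<=` radical I ->
  exists y : 'I_d -> R, H = ideal_gen (range y).
Proof.
move=> cm dimR [red minH] Im mI; have [iH HI [n In]] := red.
have Hm : H `<=` m by exact: subset_trans Im.
have mH : m `<=` radical H.
  move=> x /mI [p Ixp]; exists (p * n.+1)%N; rewrite exprM.
  apply: (ideal_mul_subl iH (B := ideal_pow I n)); rewrite -In.
  exact: mem_ideal_pow.
have [c hc] := hilbert_samuel_bound cm dimR iH mH.
have exr : exists r, `[< exists y : 'I_r -> R, H = ideal_gen (range y) >].
  by have [r yH] := R_noeth iH; exists r; apply/asboolP.
have [r /asboolP [y Hy] minr] := ex_minnP exr.
(* For the least number [r] of generators, [r > d] would yield a reduction with [r - 1] generators,
   equal to [H] by minimality. *)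
have [rd|dr] := leqP r d; last first.
  case: r => [//|r] in y Hy minr dr *.
  have hy i : H (y i) by rewrite Hy; exact: (mem_range_gen (a := y)).
  have [e [p [hp pa py]]] := homogeneous_relation hy dr hc.
  have [y' red'] := reduction_fewer_generators Hy Hm hp pa py.
  have JH : ideal_gen (range y') = H.
    by apply: minH; [exact: reduction_trans red|have [] := red'].
  suff : (r < r)%N by rewrite ltnn.
  by apply: minr; apply/asboolP; exists y'; rewrite JH.
(* The family is padded with zeros to have exactly [d] members. *)
exists (fun i : 'I_d => if insub (val i) is Some j then y j else 0).
rewrite Hy; apply/seteqP; split; apply: (ideal_gen_min (ideal_gen_is_ideal _)).
  move=> _ [j _ <-]; apply: mem_ideal_gen; exists (widen_ord rd j) => //=.
  by rewrite valK.
move=> _ [i _ <-]; case: insubP => [j _ _|_]; first exact: (mem_range_gen (a := y)).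
exact: (ideal0 (ideal_gen_is_ideal _)).
Qed.

End Reduction.

(** * General elements *)

Section Image.
Context {R : comNzRingType} {S : comPzRingType} (f : {rmorphism R -> S}).
Implicit Types (A B I : set R) (X : set S).
Hypothesis f_surj : forall u, exists x, f x = u.

Lemma image_ideal A : is_ideal A -> is_ideal (f @` A).
Proof.
move=> iA; split=> [|_ _ [x Ax <-] [y Ay <-]|u _ [y Ay <-]].
- by exists 0; [exact: ideal0|rewrite rmorph0].
- by exists (x + y); [exact: idealD|rewrite rmorphD].
- have [x <-] := f_surj u; exists (x * y); last by rewrite rmorphM.
  exact: (idealMl _ iA).
Qed.

Lemma preimage_ideal X : is_ideal X -> is_ideal [set x | X (f x)].
Proof.
move=> iX; split=> [|x y /= Xx Xy|x y /= Xy].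
- by rewrite /= rmorph0; exact: ideal0.
- by rewrite rmorphD; exact: (idealD iX).
- by rewrite rmorphM; exact: (idealMl _ iX).
Qed.

Lemma ideal_pow_image I n : ideal_pow (f @` I) n = f @` ideal_pow I n.
Proof.
elim: n => [|n ih] /=; first by apply/seteqP; split=> // u _; have [x <-] := f_surj u; exists x.
rewrite ih; apply/seteqP; split.
  apply: ideal_mul_min; first by apply: image_ideal; exact: ideal_mul_ideal.
  move=> _ _ [x Ix <-] [y Iy <-]; exists (x * y); last by rewrite rmorphM.
  exact: mem_ideal_mul.
move=> _ [x Ix <-]; move: x Ix; set X := ideal_mul (f @` _) _.
apply: (ideal_mul_min (X := [set x | X (f x)])).
  by apply: preimage_ideal; exact: ideal_mul_ideal.
by move=> x y Ix Iy /=; rewrite rmorphM; apply: mem_ideal_mul; [exists x|exists y].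
Qed.

End Image.

Section LengthOne.
Context {R : comNzRingType} {k : fieldType} (pi : {rmorphism R -> k}).
Variable m : set R.
Hypotheses (m_ideal : is_ideal m) (mE : m = [set x | pi x = 0]).
Hypothesis pi_unit : forall x, pi x != 0 -> exists y, y * x = 1.
Implicit Types (A V Y : set R).

(** Any element of [A] outside [B] serves as [w], because no chain of two strict steps fits between
    [B] and [A]. *)
Lemma length_le1_length_one A V Y : is_ideal A -> is_ideal V -> is_ideal Y ->
  ideal_add V Y `<=` A -> length_le A (ideal_add V Y) 1 -> length_one m A V Y.
Proof.
move=> iA iV iY; rewrite /length_one; set B := ideal_add V Y => BA AB.
have iB : is_ideal B by exact: ideal_add_ideal.
have [sAB|/existsNP [w /not_implyP [Aw nBw]]] := pselect (A `<=` B).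
  exists 0; split; first exact: ideal0.
    by apply: subset_trans sAB _; exact: adjoin_sub.
  by apply: subset_trans sAB; exact: ideal_mul_subr.
have no_between N N' : is_ideal N -> is_ideal N' -> N' `<=` A -> B `<` N -> ~ N `<` N'.
  move=> iN iN' N'A BN NN'.
  suff : (2 <= 1)%N by [].
  have [sBN _] := BN; have [sNN' _] := NN'.
  apply: (AB 2%N (fun i => if i is i'.+1 then (if i' is 0 then N else N') else B)).
    move=> [|[|[|//]]] _; split=> //.
    - by move=> x /sNN' /N'A.
    - by move=> x /sBN /sNN'.
  by move=> [|[|//]].
exists w; split=> //.
  apply: contrapT => /existsNP [x /not_implyP [Ax nx]].
  apply: (no_between (adjoin B w) A) => //; [exact: adjoin_ideal|exact: adjoin_proper|].
  by split=> [|/(_ x Ax)//]; exact: (adjoin_min iA).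
(* Otherwise [B], [B + (q w)], [B + (w)] is a strict chain: equality of the last two would put
   [(1 - r q) w] in [B], with [1 - r q] a unit. *)
have mw q : m q -> B (q * w).
  move=> mq; apply: contrapT => nBqw.
  apply: (no_between (adjoin B (q * w)) (adjoin B w)).
  - exact: adjoin_ideal.
  - exact: adjoin_ideal.
  - exact: (adjoin_min iA).
  - exact: adjoin_proper.
  split.
    apply: adjoin_min; [exact: adjoin_ideal|exact: adjoin_sub|].
    by exists q; rewrite subrr; exact: ideal0.
  move=> /(_ w (mem_adjoin w iB)) [r Br]; apply: nBw.
  apply: (local_cancel pi_unit iB (x := 1 - r * q)).
    rewrite rmorphB rmorph1 rmorphM; move: mq; rewrite mE /= => ->.
    by rewrite mulr0 subr0 oner_eq0.
  by rewrite mulrBl mul1r -mulrA.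
apply: (ideal_mul_min iB) => q x mq Ax.
have [r Br] : adjoin B w x.
  apply: contrapT => nx.
  apply: (no_between (adjoin B w) A) => //; [exact: adjoin_ideal|exact: adjoin_proper|].
  by split=> [|/(_ x Ax)//]; exact: (adjoin_min iA).
rewrite -(subrK (r * w) x) mulrDr; apply: (idealD iB); first exact: (idealMl _ iB).
by rewrite mulrCA; apply: (idealMl _ iB); exact: mw.
Qed.

(** An element of [A] whose coefficient on [w] lies in [m] falls in [V + Y], and any other one spans
    [A] modulo [V + Y]. Hence the first proper step of a chain already reaches all of [A']. *)
Lemma length_one_image (S : comPzRingType) (f : {rmorphism R -> S}) A V Y (A' X : set S) :
  length_one m A V Y -> is_ideal X -> A' `<=` f @` A ->
  (forall x, ideal_add V Y x -> X (f x)) -> length_le A' X 1.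
Proof.
move=> [w [Aw Aadj mA]] iX A'A BX l N hN sN; rewrite leqNgt; apply/negP => l2.
have [_ XN0 _] := hN 0%N isT; have [iN1 XN1 N1A] := hN 1%N (ltnW l2).
have [_ _ N2A] := hN 2%N l2.
have [_ /existsNP [u /not_implyP [N1u nN0u]]] := sN 0%N (ltnW l2).
have [a Aa ua] := A'A _ (N1A _ N1u).
have [_] := sN 1%N l2; apply=> v N2v; have [b Ab vb] := A'A _ (N2A _ N2v).
have [r Br] := Aadj _ Aa; have [s Bs] := Aadj _ Ab.
have [r0|/eqP r0] := pselect (pi r = 0).
  exfalso; apply: nN0u; rewrite -ua; apply: XN0; rewrite -(subrK (r * w) a) rmorphD.
  by apply: (idealD iX); apply: BX => //; apply: mA; apply: mem_ideal_mul; rewrite ?mE.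
have [t tr] := pi_unit r0.
rewrite -vb; have -> : b = (b - s * w) - s * t * (a - r * w) + s * t * a.
  by rewrite mulrBr !mulrA -(mulrA s t r) tr mulr1; ring.
rewrite rmorphD rmorphB !(rmorphM f (s * t)) ua; apply: (idealD iN1).
  by apply: XN1; apply: (idealB iX); [exact: BX|apply: (idealMl _ iX); exact: BX].
exact: (idealMl _ iN1).
Qed.

End LengthOne.

Section ProductFamily.
Context {R : comNzRingType} {d s : nat}.
Variable a : 'I_s -> R.

Let square := #|{: 'I_s * 'I_s}|.
Let rect := #|{: 'I_d * 'I_s}|.

Definition product_gens : 'cV[R]_square :=
  \col_p (a (enum_val p).1 * a (enum_val p).2).

(* Coordinates of the products [x_i a_l], where [x_i = \sum_j 'X_(i, j) a_j], on the
   products [a_j a_l]. *)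
Definition generic_products : 'M[{mpoly R[d * s]}]_(rect, square) :=
  \matrix_(u, p) if (enum_val u).2 == (enum_val p).2
    then 'X_(mxvec_index (enum_val u).1 (enum_val p).1) else 0.

Lemma generic_productsE (L : 'M[R]_(d, s)) u :
  (map_mx (meval (fun i => mxvec L 0 i)) generic_products *m product_gens) u 0 =
  (\sum_j L (enum_val u).1 j * a j) * a (enum_val u).2.
Proof.
rewrite mxE (reindex _ (onW_bij _ (@enum_rank_bij {: 'I_s * 'I_s}))) /=.
under eq_bigr => p _ do rewrite !mxE !enum_rankK.
rewrite -(pair_big xpredT xpredT (fun j l =>
  (if (enum_val u).2 == l then 'X_(mxvec_index (enum_val u).1 j) else 0).@[
    fun i => mxvec L 0 i] * (a j * a l))) /=.
rewrite mulr_suml; apply: eq_bigr => j _.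
rewrite (bigD1 (enum_val u).2) //= eqxx mevalXU mxvecE big1 ?addr0 ?mulrA // => l.
by rewrite eq_sym => /negPf ->; rewrite meval0 mul0r.
Qed.

Lemma colgen_generic_products (L : 'M[R]_(d, s)) :
  colgen (map_mx (meval (fun i => mxvec L 0 i)) generic_products *m product_gens) =
  ideal_mul (ideal_gen (range (fun i => \sum_j L i j * a j))) (ideal_gen (range a)).
Proof.
apply/seteqP; split.
  apply: (colgen_sub (ideal_mul_ideal _ _)) => u; rewrite generic_productsE.
  by apply: mem_ideal_mul; apply: mem_ideal_gen; eexists.
set V := colgen _; have iV : is_ideal V by exact: colgen_ideal.
apply: (ideal_mul_min iV) => _ _ /ideal_gen_rangeP [r ->] /ideal_gen_rangeP [t ->].
rewrite mulr_suml; apply: (ideal_sum _ iV) => i _.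
rewrite mulr_sumr; apply: (ideal_sum _ iV) => j _.
rewrite mulrACA; apply: (idealMl _ iV).
have := mem_colgen
  (e := map_mx (meval (fun i => mxvec L 0 i)) generic_products *m product_gens)
  (enum_rank (i, j)).
by rewrite generic_productsE enum_rankK.
Qed.

Lemma colgen_product_gens : colgen product_gens = ideal_pow (ideal_gen (range a)) 2.
Proof.
rewrite ideal_pow2; last exact: ideal_gen_is_ideal.
apply/seteqP; split.
  apply: (colgen_sub (ideal_mul_ideal _ _)) => p; rewrite mxE.
  by apply: mem_ideal_mul; apply: mem_ideal_gen; eexists.
set V := colgen _; have iV : is_ideal V by exact: colgen_ideal.
apply: (ideal_mul_min iV) => _ _ /ideal_gen_rangeP [r ->] /ideal_gen_rangeP [t ->].
rewrite mulr_suml; apply: (ideal_sum _ iV) => i _.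
rewrite mulr_sumr; apply: (ideal_sum _ iV) => j _.
rewrite mulrACA; apply: (idealMl _ iV).
by have := mem_colgen (e := product_gens) (enum_rank (i, j)); rewrite mxE enum_rankK.
Qed.

End ProductFamily.

Theorem corollary5p4 (R : comNzRingType) (m : set R)
    (k : fieldType) (pi : {rmorphism R -> k}) (d : nat) (I : set R)
    (R_cm : cohen_macaulay_local m)
    (k_residue : residue_map pi m)
    (R_equichar : equicharacteristic R k)
    (k_infinite : infinite_set [set: k])
    (R_dim : krull_dim R d)
    (d_ge1 : (1 <= d)%N)
    (I_stretched : stretched m I) :
  j_stretched pi d I.
Proof.
have [noeth lm _] := R_cm; have [pi_surj mE] := k_residue.
have [[im m1 mmax] _] := lm.
have pi_unit x : pi x != 0 -> exists y, y * x = 1.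
  by move=> px; apply: (local_unit noeth lm); rewrite mE /= => px0; rewrite px0 eqxx in px.
have [[[iI _ _] radI] [H [minH HI2 HI_len]]] := I_stretched.
have Im : I `<=` m by move=> x Ix; rewrite -radI; exists 1%N.
have mI : m `<=` radical I by rewrite radI.
have [y Hy] := minimal_reduction_generators noeth k_infinite im mE pi_surj pi_unit
  R_cm R_dim minH Im mI.
have [[iH HI _] _] := minH.
move=> s a Ia.
(* [L0] is the point of the parameter space at which [(x_1, ..., x_d)] equals [H]. *)
have [L0 L0P] : exists L0 : 'M[R]_(d, s), y = fun i => \sum_j L0 i j * a j.
  have /choice [r rP] : forall i, exists r : 'I_s -> R, y i = \sum_j r j * a j.
    move=> i; apply/ideal_gen_rangeP; rewrite -Ia; apply: HI.
    by rewrite Hy; exact: (mem_range_gen (a := y)).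
  exists (\matrix_(i, j) r i j); apply/funext => i; rewrite rP.
  by apply: eq_bigr => j _; rewrite mxE.
have e2 : colgen (product_gens a) = ideal_pow I 2 by rewrite colgen_product_gens -Ia.
have iP n := ideal_pow_ideal I n.
have I3 : ideal_pow I 3 `<=` ideal_mul m (ideal_pow I 2).
  by rewrite [ideal_pow I 3]/= ideal_mulC; apply: ideal_mulS.
have [||D D0 DP] := @generic_length_one _ _ pi m noeth k_infinite im mE pi_surj pi_unit
    _ _ _ (product_gens a) (@generic_products R d s) (fun i => mxvec L0 0 i)
    (ideal_pow I 3) (iP 3%N).
- by rewrite e2.
(* The equality of [H I] with the intersection of [H] and [I^2] turns the stretched condition into a
   bound for [I^2 / (H I + I^3)]. *)
- rewrite colgen_generic_products e2 -Ia -L0P -Hy.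
  apply: (length_le1_length_one mE pi_unit (iP 2%N) (ideal_mul_ideal H I) (iP 3%N)).
    apply: (ideal_add_min (iP 2%N)); last exact: ideal_pow_le.
    by rewrite -HI2 => x [].
  by rewrite -HI2.
exists [set v | D.@[fun i => mxvec v 0 i] != 0]; split.
- exact: principal_zariski_open.
- exact: principal_zariski_dense.
move=> L DL l ld J K Ibar xdbar.
have {DP} := DP (fun i => mxvec L 0 i).
(* The condition on [L] involves only its image over [k]. *)
have -> : (fun i => pi (mxvec L 0 i)) = (fun i => mxvec (map_mx pi L) 0 i).
  by apply/funext => i; rewrite -map_mxvec mxE.
move=> /(_ DL); rewrite colgen_generic_products e2 -Ia => one.
have proj_surj (u : quot_ring K) : exists x, quot_proj K x = u.
  by exists (quot_repr u); exact: quot_reprK.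
have ipow n := ideal_pow_ideal Ibar n.
have iX := ideal_add_ideal (ideal_mul_ideal (ideal_gen [set xdbar]) Ibar) (ipow 3%N).
apply: (length_one_image (f := quot_proj K) mE pi_unit one iX).
  by rewrite /Ibar ideal_pow_image.
move=> _ [u Vu [v I3v <-]]; rewrite rmorphD; apply: (idealD iX); last first.
  apply: ideal_add_subr; first exact: ideal_mul_ideal.
  by rewrite /Ibar ideal_pow_image //; exists v.
set X := ideal_add _ _ in iX *.
have iP' := preimage_ideal (quot_proj K) iX.
move: u Vu; apply: (ideal_mul_min iP') => x b + Ib.
move=> /ideal_gen_rangeP [r ->]; rewrite mulr_suml; apply: (ideal_sum _ iP') => i _.
rewrite -mulrA; apply: (idealMl _ iP').
change (X (quot_proj K ((\sum_j L i j * a j) * b))).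
(* For [i = l] the element is [x_d]; for [i < l] it vanishes in the quotient by the saturation. *)
have [il|li] := ltnP i l; last first.
  have -> : i = l by apply/val_inj/eqP; rewrite eqn_leq li andbT -ltnS ld ltn_ord.
  apply: (ideal_add_subl (ipow 3%N)); rewrite rmorphM.
  by apply: mem_ideal_mul; [exact: mem_ideal_gen|exists b].
suff -> : quot_proj K ((\sum_j L i j * a j) * b) = 0 by exact: (ideal0 iX).
rewrite -(rmorph0 (quot_proj K)); apply/quot_projP; rewrite subr0.
have gK := ideal_gen_is_ideal K; apply: (idealMr _ gK); apply: mem_ideal_gen.
(* Exponent [1] suffices, since [x_i] already lies in [J]. *)
exists 1%N => // c _; apply: (idealMr _ (ideal_gen_is_ideal _)).
by apply: mem_ideal_gen; exists i.
Qed.
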